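(* Let $X$ be a finite CW complex and let $A\subset B\subset X$ be subcomplexes of $X$. Let $\xi\in H^1(X;\mathbb{R})$ and let $i^{\ast}:H^1(X;\mathbb{R})\to H^1(B;\mathbb{R})$ be the map induced by the inclusion $i:B\to X$. Then $$\mathrm{cat}(X,A,\xi)\;\leq\;\mathrm{cat}(X,B,\xi)+\mathrm{cat}\big(B,A,i^{\ast}(\xi)\big).$$
   Context: **Continuous closed 1-forms.** A continuous closed 1-form $\omega$ on a topological space $X$ is a collection $\{f_U\}_{U\in\mathscr{U}}$ of continuous functions $f_U:U\to\mathbb{R}$, where $\mathscr{U}$ is an open cover of $X$, such that for all $U,V\in\mathscr{U}$ the difference $f_U|_{U\cap V}-f_V|_{U\cap V}$ is locally constant. For a continuous path $\gamma:[0,1]\to X$ the line integral is $\int_\gamma\omega=\sum_{i=0}^{n-1}\big(f_{U_i}(\gamma(t_{i+1}))-f_{U_i}(\gamma(t_i))\big)$, where $0=t_0<t_1<\dots<t_n=1$ is a partition with $\gamma([t_i,t_{i+1}])\subset U_i\in\mathscr{U}$; it is independent of choices. Integration over loops gives the homomorphism of periods $\pi_1(X,x_0)\to\mathbb{R}$, and so a class $[\omega]\in H^1(X;\mathbb{R})$. On a CW complex every class in $H^1(X;\mathbb{R})$ is $[\omega]$ for some continuous closed 1-form $\omega$. **Movability.** Let $(X,B)$ be a finite CW pair ($B$ may be empty), $\omega$ a continuous closed 1-form on $X$, $N$ a positive integer and $C>0$ real. A subset $D\subset X$ containing $B$ is $(N,C)$-movable relative to $B$ (with respect to $\omega$) if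 there is a continuous homotopy $h:D\times[0,1]\to X$ such that $h_0$ is the inclusion, $h_t(B)\subset B$ for all $t\in[0,1]$, for every $x\in D$ either $h_1(x)\in B$ or $\int_x^{h_1(x)}\omega\leq -N$, and $\int_x^{h_t(x)}\omega\leq C$ for all $x\in D$, $t\in[0,1]$. Here $\int_x^{h_t(x)}\omega$ is the integral along the path $s\mapsto h_s(x)$, $s\in[0,t]$. **Relative category.** For a finite CW pair $(X,B)$ and $\xi=[\omega]\in H^1(X;\mathbb{R})$, $\mathrm{cat}(X,B,\xi)$ is the smallest integer $k\ge 0$ for which there exists $C>0$ such that for every integer $N>0$ there is an open cover $X=U\cup U_1\cup\dots\cup U_k$ such that each inclusion $U_i\hookrightarrow X$ is null-homotopic ($1\le i\le k$) and $U$ is $(N,C)$-movable relative to $B$ with respect to $\omega$. This number does not depend on the choice of $\omega$ representing $\xi$. *)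

(* Defs.v *)
From HB Require Import structures.
From mathcomp Require Import all_boot all_order all_algebra.
From mathcomp Require Import all_classical all_reals all_analysis.

Set Implicit Arguments.
Unset Strict Implicit.
Unset Printing Implicit Defensive.

Import Order.TTheory GRing.Theory Num.Theory.
Import numFieldNormedType.Exports.

Local Open Scope classical_set_scope.
Local Open Scope ring_scope.

(* The library norm on 'rV[R]_n is the sup norm, hence the sums of squares. *)
Definition disc (R : realType) (n : nat) : set 'rV[R]_n :=
  [set x | \sum_(i < n) x 0 i ^+ 2 <= 1].
Definition open_disc (R : realType) (n : nat) : set 'rV[R]_n :=
  [set x | \sum_(i < n) x 0 i ^+ 2 < 1].
Definition sphere (R : realType) (n : nat) : set 'rV[R]_n :=
  [set x | \sum_(i < n) x 0 i ^+ 2 = 1].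

Arguments disc : clear implicits.
Arguments open_disc : clear implicits.
Arguments sphere : clear implicits.

(* Whitehead's definition. As there are finitely many cells and X is Hausdorff,
   closure-finiteness, the weak topology and the fact that characteristic maps
   are homeomorphisms from the open discs to the open cells are automatic. *)
Record finite_cw (R : realType) (X : topologicalType) := FiniteCW {
  cell : finType;
  cell_dim : cell -> nat;
  char_map : forall e : cell, 'rV[R]_(cell_dim e) -> X;
  cw_hausdorff : hausdorff_space X;
  char_map_continuous : forall e,
    {within disc R (cell_dim e), continuous (@char_map e)};
  char_map_inj : forall e, set_inj (open_disc R (cell_dim e)) (@char_map e);
  cells_disjoint :
    trivIset [set: cell] (fun e => @char_map e @` open_disc R (cell_dim e));
  cells_cover :
    \bigcup_(e : cell) (@char_map e @` open_disc R (cell_dim e)) = [set: X];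
  cell_boundary : forall e,
    @char_map e @` sphere R (cell_dim e) `<=`
    \bigcup_(e' in [set e' | (cell_dim e' < cell_dim e)%N])
      (@char_map e' @` open_disc R (cell_dim e')) }.

Definition open_cell (R : realType) (X : topologicalType) (K : finite_cw R X)
    (e : cell K) : set X :=
  @char_map R X K e @` open_disc R (cell_dim e).

Definition subcomplex (R : realType) (X : topologicalType) (K : finite_cw R X)
    (A : set X) : Prop :=
  closed A /\ exists J : set (cell K), A = \bigcup_(e in J) open_cell e.

Definition std_simplex (R : realType) (n : nat) : set 'rV[R]_n.+1 :=
  [set x | (forall i, 0 <= x 0 i) /\ \sum_i x 0 i = 1].
Arguments std_simplex : clear implicits.

Definition singular_simplex (R : realType) (n : nat) (X : topologicalType) :=
  continuousType (set_type (std_simplex R n)) X.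

Definition cochain (R : realType) (n : nat) (X : topologicalType) : Type :=
  singular_simplex R n X -> R.

Lemma row_valued_continuous (R : realType) (T : topologicalType) (n : nat)
    (f : T -> 'rV[R]_n) :
  (forall i, continuous (fun x => f x 0 i)) -> continuous f.
Proof.
move=> fcont x V [P Pnbhs PV].
have near_f : \forall y \near x, forall i, P 0 i (f y 0 i).
  by apply: filter_forall => i; apply: (fcont i x); exact: Pnbhs.
apply: filterS near_f => y Py; apply: PV => i j.
by rewrite (ord1 i); exact: Py.
Qed.

Section Face.
Context (R : realType) (n : nat) (j : 'I_n.+2).

(* The j-th face inclusion inserts the barycentric coordinate 0 at place j. *)
Definition face_row (x : 'rV[R]_n.+1) : 'rV[R]_n.+2 :=
  \row_i (if unlift j i is Some k then x 0 k else 0).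

Lemma face_row_std_simplex (x : set_type (std_simplex R n)) :
  face_row (val x) \in std_simplex R n.+1.
Proof.
apply/mem_set; have [x_ge0 x_sum] := set_valP x; split=> [i|].
  by rewrite mxE; case: unlift.
rewrite (bigD1_ord j) //= mxE unlift_none add0r -[RHS]x_sum.
by apply: eq_bigr => k _; rewrite mxE liftK.
Qed.

Definition face (x : set_type (std_simplex R n)) :
  set_type (std_simplex R n.+1) := SigSub (face_row_std_simplex x).

Lemma face_continuous : continuous face.
Proof.
apply: continuous_comp_initial.
have -> : set_val \o face = face_row \o set_val.
  by apply/funext => x; rewrite /= !set_valE.
apply: row_valued_continuous => i x.
apply: (@continuous_comp _ _ _ set_val (fun y => face_row y 0 i)).
  exact: initial_continuous.
have -> : (fun y => face_row y 0 i) =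
    (fun y => if unlift j i is Some k then y 0 k else 0).
  by apply/funext => y; rewrite mxE.
case: unlift => [k|]; first exact: coord_continuous.
exact: cst_continuous.
Qed.

HB.instance Definition _ := isContinuous.Build _ _ face face_continuous.

End Face.

Definition singular_face (R : realType) (n : nat) (X : topologicalType)
    (j : 'I_n.+2) (s : singular_simplex R n.+1 X) : singular_simplex R n X :=
  [the continuousType _ _ of s \o face j].

Definition coboundary (R : realType) (n : nat) (X : topologicalType)
    (c : cochain R n X) : cochain R n.+1 X :=
  fun s => \sum_(j < n.+2) (-1) ^+ j * c (singular_face j s).

Definition cocycle (R : realType) (n : nat) (X : topologicalType)
    (c : cochain R n X) : Prop :=
  forall s, coboundary c s = 0.

Definition cohomologous (R : realType) (n : nat) (X : topologicalType)
    (c c' : cochain R n.+1 X) : Prop :=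
  exists b : cochain R n X, forall s, c' s = c s + coboundary b s.

(* Elements of H^1(X; R) = Z^1 / B^1 are the cosets of B^1 in Z^1. *)
Record H1 (R : realType) (X : topologicalType) := MkH1 {
  H1_coset : set (cochain R 1 X);
  H1_cosetP : exists2 c, cocycle c & H1_coset = [set c' | cohomologous c c'] }.
Arguments H1_cosetP {R X} _.

Section Pullback.
Context (R : realType) (X Y : topologicalType) (f : continuousType X Y).

Definition pull_cochain (n : nat) (c : cochain R n Y) : cochain R n X :=
  fun s => c [the continuousType _ _ of f \o s].

Lemma coboundary_pull (n : nat) (c : cochain R n Y) :
  coboundary (pull_cochain c) = pull_cochain (coboundary c).
Proof.
apply/funext => s; apply: eq_bigr => j _; congr (_ * c _).
exact/continuousEP.
Qed.

Definition pull_coset (xi : H1 R Y) : set (cochain R 1 X) :=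
  [set c' | exists2 c, H1_coset xi c & cohomologous (pull_cochain c) c'].

Lemma pull_cosetP (xi : H1 R Y) :
  exists2 c, cocycle c & pull_coset xi = [set c' | cohomologous c c'].
Proof.
have [c cZ xiE] := H1_cosetP xi; exists (pull_cochain c).
  by move=> s; rewrite coboundary_pull /pull_cochain cZ.
rewrite /pull_coset xiE; apply/seteqP; split=> [c'|c' cc'] /=; last first.
  exists c => //; exists (fun=> 0) => s.
  by rewrite /coboundary big1 ?addr0 // => j _; rewrite mulr0.
move=> [d [b db] [b' c'E]]; exists (fun s => pull_cochain b s + b' s) => s.
rewrite c'E /pull_cochain db -addrA; congr (_ + _).
have := congr1 (fun h => h s) (coboundary_pull b); rewrite /pull_cochain => <-.
by rewrite /coboundary -big_split /=; apply: eq_bigr => j _; rewrite -mulrDr.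
Qed.

Definition H1_pull (xi : H1 R Y) : H1 R X := MkH1 (pull_cosetP xi).

End Pullback.

Section Inclusion.
Context (X : topologicalType) (B : set X).

Definition sub_val (x : set_type B) : X := val x.

Lemma sub_val_continuous : continuous sub_val.
Proof.
rewrite (_ : sub_val = set_val); last by apply/funext => x; rewrite set_valE.
exact: initial_continuous.
Qed.

HB.instance Definition _ := isContinuous.Build _ _ sub_val sub_val_continuous.

Definition sub_incl : continuousType (set_type B) X :=
  [the continuousType _ _ of sub_val].

End Inclusion.

(* The values of form_fun U outside U are irrelevant. *)
Record closed_form (R : realType) (X : topologicalType) := ClosedForm {
  form_cover : set (set X);
  form_fun : set X -> X -> R;
  form_cover_open : forall U, form_cover U -> open U;
  form_coverT : \bigcup_(U in form_cover) U = [set: X];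
  form_fun_continuous : forall U, form_cover U ->
    {within U, continuous (form_fun U)};
  form_fun_closed : forall U V, form_cover U -> form_cover V ->
    forall x, (U `&` V) x -> \forall y \near x, (U `&` V) y ->
      form_fun U y - form_fun V y = form_fun U x - form_fun V x }.

(* v is computed from some partition a = t 0 < ... < t n = b subordinate to the
   cover; gamma only matters on [a, b], and a = b forces n = 0. *)
Definition is_line_integral (R : realType) (X : topologicalType)
    (w : closed_form R X) (gamma : R -> X) (a b v : R) : Prop :=
  exists (n : nat) (t : nat -> R) (U : nat -> set X),
    [/\ t 0%N = a, t n = b, forall i, (i < n)%N -> t i < t i.+1,
        forall i, (i < n)%N ->
          form_cover w (U i) /\ gamma @` `[t i, t i.+1] `<=` U i
      & v = \sum_(0 <= i < n) (form_fun w (U i) (gamma (t i.+1)) -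
                               form_fun w (U i) (gamma (t i)))].

Definition line_integral (R : realType) (X : topologicalType)
    (w : closed_form R X) (gamma : R -> X) (a b : R) : R :=
  xget 0 [set v | is_line_integral w gamma a b v].

Section EdgePath.
Context (R : realType).

Definition clamp (t : R) : R := Num.max 0 (Num.min 1 t).

Lemma edge_std_simplex (t : R) :
  (\row_(i < 2) (if i == 0 then 1 - clamp t else clamp t)) \in std_simplex R 1.
Proof.
apply/mem_set; split=> [i|].
  rewrite mxE; case: ifP => _; last by rewrite /clamp le_max lexx.
  by rewrite subr_ge0 /clamp ge_max ler01 ge_min lexx.
by rewrite !big_ord_recl big_ord0 !mxE /= addr0 subrK.
Qed.

(* The path t |-> (1 - t, t) from the first to the second vertex of the standard
   1-simplex, extended by constants outside [0, 1]. *)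
Definition edge (t : R) : set_type (std_simplex R 1) :=
  SigSub (edge_std_simplex t).

End EdgePath.

Definition form_cochain (R : realType) (X : topologicalType)
    (w : closed_form R X) : cochain R 1 X :=
  fun s => line_integral w (s \o @edge R) 0 1.

(* A coset containing the cochain of w is its class [w], so this is [w] = xi. *)
Definition represents (R : realType) (X : topologicalType)
    (w : closed_form R X) (xi : H1 R X) : Prop :=
  H1_coset xi (form_cochain w).

Definition movable (R : realType) (X : topologicalType) (w : closed_form R X)
    (B : set X) (N : nat) (C : R) (D : set X) : Prop :=
  B `<=` D /\
  exists h : X -> R -> X,
    [/\ {within D `*` `[0, 1], continuous (fun p : X * R => h p.1 p.2)},
        forall x, D x -> h x 0 = x,
        forall x t, B x -> 0 <= t <= 1 -> B (h x t),
        forall x, D x -> B (h x 1) \/ line_integral w (h x) 0 1 <= - N%:R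
      & forall x t, D x -> 0 <= t <= 1 -> line_integral w (h x) 0 t <= C].

Definition null_homotopic_incl (R : realType) (X : topologicalType)
    (U : set X) : Prop :=
  exists (h : X -> R -> X) (x0 : X),
    [/\ {within U `*` `[0, 1], continuous (fun p : X * R => h p.1 p.2)},
        forall x, U x -> h x 0 = x
      & forall x, U x -> h x 1 = x0].
Arguments null_homotopic_incl : clear implicits.

Definition cat_admissible (R : realType) (X : topologicalType) (B : set X)
    (xi : H1 R X) (k : nat) : Prop :=
  exists2 w : closed_form R X, represents w xi &
  exists2 C : R, 0 < C &
  forall N : nat, (0 < N)%N ->
    exists (U : set X) (V : 'I_k -> set X),
      [/\ open U, forall i, open (V i), U `|` \bigcup_i V i = [set: X],
          forall i, null_homotopic_incl R X (V i)
        & movable w B N C U].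

(* cat(X, B, xi): the choice of the form w representing xi in cat_admissible does
   not matter, and the infimum of a set of natural numbers is its least element,
   or +oo if the set is empty. *)
Definition relcat (R : realType) (X : topologicalType) (B : set X) (xi : H1 R X) :
  \bar R := ereal_inf [set k%:R%:E | k in cat_admissible B xi].

(* Main.v *)
Require Import Defs.
From mathcomp Require Import all_boot all_order all_algebra.
From mathcomp Require Import all_classical all_reals all_analysis.
From mathcomp Require Import ring lra.

(** Take a cover U, U_1, ..., U_m of X for B and a cover V, V_1, ..., V_n of B for
    A. The sets U_i are kept. A point of U is moved by the motion h of U until it
    either has descended far enough or lies in B; in the second case it lies in
    V or in some V_j. Those which end in V_j can be contracted along V_j, and
    those which end in V can go on along the motion g of V, so the set of points
    of U which have descended far enough or end in V is movable relative to A,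
    and m + n null-homotopic sets remain. Four points need care.

    The sets V and V_j are open in B only. A subcomplex B is a deformation
    retract of an open set O by a motion r which fixes B, as one sees by adding
    the other cells one at a time and pushing each of them away from its centre
    ([subcomplex_retraction]). Hence one thickens V and V_j to their preimages
    under r_1, and inserts r between h and g.

    The motion h keeps B invariant, but the new motion must keep A invariant.
    Sliding a neighbourhood of B into B along r first, one can afford to run h
    for a time which vanishes on B, so h may be taken to fix B pointwise
    ([movable_stationary]).

    Points which have descended far enough along h and points which go on along
    g must be joined continuously: the second motion is run for a time chi which
    is given by the Urysohn lemma ([continuation_movable]). A partially performed
    second motion costs a bounded amount, which a larger N compensates.

    The forms on X and on B are only related through their classes. Their
    integrals along paths of B differ by the increments of a function beta on B
    ([pull_line_integral]), and beta is bounded because its variation on a closed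
    cell is a difference of two integrals along the rays of a disc, which depend
    continuously on the ray ([increments_bounded]).

    All estimates rest on one property of line integrals: along a path they are
    primitives of the form, in the sense of local increments, and primitives
    are unique up to constants ([line_integral_primitive]). *)

Set Implicit Arguments.
Unset Strict Implicit.
Unset Printing Implicit Defensive.

Import Order.TTheory GRing.Theory Num.Theory.
Import numFieldNormedType.Exports.

Local Open Scope classical_set_scope.
Local Open Scope ring_scope.

(** * Maps which are continuous on a subset *)

Lemma within_nbhsP {T U : topologicalType} (D : set T) (f : T -> U) :
  {within D, continuous f} <->
  forall x, D x -> forall W, nbhs (f x) W -> \forall y \near x, D y -> W (f y).
Proof.
split=> [/subspace_continuousP fc x Dx W /(fc x Dx) //|fc].
by apply/subspace_continuousP => x Dx W /(fc x Dx).
Qed.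

Section Within.
Context {S T U : topologicalType}.

Lemma within_eq (D : set T) (f g : T -> U) : (forall x, D x -> f x = g x) ->
  {within D, continuous f} -> {within D, continuous g}.
Proof.
move=> fg /within_nbhsP fc; apply/within_nbhsP => x Dx W; rewrite -fg// => Wx.
by apply: filterS (fc x Dx W Wx) => y Wy Dy; rewrite -fg//; exact: Wy.
Qed.

Lemma within_continuous_subset (T' U' : topologicalType) (D E : set T')
    (f : T' -> U') : E `<=` D ->
  {within D, continuous f} -> {within E, continuous f}.
Proof.
move=> ED /within_nbhsP fc; apply/within_nbhsP => x Ex W Wx.
by apply: filterS (fc x (ED _ Ex) W Wx) => y Wy /ED; exact: Wy.
Qed.

Lemma within_comp (D : set S) (E : set T) (f : S -> T) (g : T -> U) :
  {within D, continuous f} -> {within E, continuous g} ->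
  (forall x, D x -> E (f x)) -> {within D, continuous (g \o f)}.
Proof.
move=> /within_nbhsP fc /within_nbhsP gc DE; apply/within_nbhsP => x Dx W Wx.
have := fc x Dx _ (gc (f x) (DE _ Dx) W Wx).
by apply: filterS => y Wy Dy; apply: Wy => //; exact: DE.
Qed.

Lemma within_closed_glue (D E F : set T) (f : T -> U) : closed E -> closed F ->
  D `<=` E `|` F -> {within D `&` E, continuous f} ->
  {within D `&` F, continuous f} -> {within D, continuous f}.
Proof.
move=> cE cF DEF /within_nbhsP fE /within_nbhsP fF.
have loc (G : set T) x W : closed G -> D x -> nbhs (f x) W ->
    (forall x, (D `&` G) x -> forall W, nbhs (f x) W ->
       \forall y \near x, (D `&` G) y -> W (f y)) ->
    \forall y \near x, D y -> G y -> W (f y).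
  move=> cG Dx Wx fG; have [Gx|nGx] := pselect (G x).
    by apply: filterS (fG x (conj Dx Gx) W Wx) => y Wy Dy Gy; exact: Wy.
  have : nbhs x (~` G) by apply: open_nbhs_nbhs; split=> //; exact: closed_openC.
  by apply: filterS => y.
apply/within_nbhsP => x Dx W Wx.
have := loc E x W cE Dx Wx fE; have := loc F x W cF Dx Wx fF.
by apply: filterS2 => y WF WE Dy; have [/WE|/WF] := DEF y Dy; exact.
Qed.

(** A continuous map on a compact set with Hausdorff target is closed, hence a
    quotient map onto its image. This is how continuity on a closed cell is read
    off from the disc. *)
Lemma within_compact_quotient (K : set S) (q : S -> T) (D : set T)
    (g : T -> U) : hausdorff_space T -> compact K ->
  {within K, continuous q} -> {within K `&` q @^-1` D, continuous (g \o q)} ->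
  {within D `&` q @` K, continuous g}.
Proof.
move=> hT cK qc /within_nbhsP gqc; apply/within_nbhsP => y [Dy _] W Wy.
(* open, and equal on K `&` q @^-1` D to the preimage of W *)
pose O := [set p : S |
  nbhs p [set p' : S | (K `&` q @^-1` D) p' -> W (g (q p'))]].
have oO : open O.
  by rewrite openE => p; rewrite /O /= => /nbhs_interior.
have cL : compact (K `&` ~` O).
  by apply: compact_closedI => //; exact: open_closedC.
have cqL : closed (q @` (K `&` ~` O)).
  apply: compact_closed => //; apply: continuous_compact cL.
  by apply: within_continuous_subset qc => p [].
have nqL : ~ (q @` (K `&` ~` O)) y.
  case=> p [Kp nOp] qp; apply: nOp; rewrite /O /=; apply: gqc => //=.
    by split=> //=; rewrite qp.
  by rewrite qp.
have : nbhs y (~` (q @` (K `&` ~` O))).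
  by apply: open_nbhs_nbhs; split=> //; exact: closed_openC.
apply: filterS => z nqLz [Dz [p Kp qp]].
have [Op|nOp] := pselect (O p); last by case: nqLz; exists p.
by rewrite -qp; apply: (nbhs_singleton Op); split=> //=; rewrite qp.
Qed.

End Within.

Section Pairs.
Context {S T U : topologicalType}.

Lemma within_pair (D : set S) (f : S -> T) (g : S -> U) :
  {within D, continuous f} -> {within D, continuous g} ->
  {within D, continuous (fun x => (f x, g x))}.
Proof.
move=> /within_nbhsP fc /within_nbhsP gc; apply/within_nbhsP => x Dx W.
case=> -[P Q] /= [fP gQ] PQW.
apply: filterS2 (fc x Dx P fP) (gc x Dx Q gQ) => y Py Qy Dy.
by apply: PQW; split=> /=; [exact: Py|exact: Qy].
Qed.

Lemma within_fst (D : set (S * T)) : {within D, continuous (@fst S T)}.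
Proof. by apply: continuous_subspaceT => x; exact: cvg_fst. Qed.

Lemma within_snd (D : set (S * T)) : {within D, continuous (@snd S T)}.
Proof. by apply: continuous_subspaceT => x; exact: cvg_snd. Qed.

End Pairs.

(** * Homotopies *)

Section Homotopies.
Context {R : realType}.
Implicit Types S T X : topologicalType.

Definition homotopy T X (D : set T) (h : T -> R -> X) :=
  {within D `*` `[0, 1], continuous (fun p : T * R => h p.1 p.2)}.

(** All motions below are obtained from others by substituting a point and a
    time which vary continuously. *)
Lemma homotopy_within S T X (E : set S) (D : set T) (h : T -> R -> X)
    (f : S -> T) (tau : S -> R) : homotopy D h ->
  {within E, continuous f} -> {within E, continuous tau} ->
  (forall y, E y -> D (f y) /\ 0 <= tau y <= 1) ->
  {within E, continuous (fun y => h (f y) (tau y))}.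
Proof.
move=> hc fc tc ED.
apply: (within_comp (within_pair fc tc) hc) => y /ED [Dy ty].
by split=> //=; rewrite in_itv.
Qed.

Lemma homotopy_path T X (D : set T) (h : T -> R -> X) x : homotopy D h ->
  D x -> {within `[0, 1], continuous (h x)}.
Proof.
move=> hc Dx; apply: (homotopy_within hc (f := fun=> x) (tau := id)).
- by apply: continuous_subspaceT => t; exact: cvg_cst.
- by apply: continuous_subspaceT => t; exact: cvg_id.
- by move=> t; rewrite /= in_itv.
Qed.

Lemma homotopy_end T X (D : set T) (h : T -> R -> X) (t : R) : homotopy D h ->
  0 <= t <= 1 -> {within D, continuous (h ^~ t)}.
Proof.
move=> hc t01; apply: (homotopy_within hc (f := id) (tau := fun=> t)) => //.
- by apply: continuous_subspaceT => x; exact: cvg_id.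
- by apply: continuous_subspaceT => x; exact: cvg_cst.
Qed.

Lemma homotopy_subset T X (D E : set T) (h : T -> R -> X) : E `<=` D ->
  homotopy D h -> homotopy E h.
Proof. by move=> ED; apply: within_continuous_subset => -[x t] /= [/ED]. Qed.

(** The second motion takes the initial point x, and not the point h x 1, as its
    argument, because it will depend on where x started. *)
Definition concat T X (h k : T -> R -> X) (x : T) (t : R) : X :=
  if t <= 2^-1 then h x (2 * t) else k x (2 * t - 1).

Lemma concat0 T X (h k : T -> R -> X) x : concat h k x 0 = h x 0.
Proof. by rewrite /concat mulr0 ifT// invr_ge0. Qed.

Lemma concat1 T X (h k : T -> R -> X) x : concat h k x 1 = k x 1.
Proof. by rewrite /concat ifF; [congr k; lra|apply/negbTE; rewrite -ltNge; lra]. Qed.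

(** For properties of all points on the track of x. *)
Lemma concat_cases T X (h k : T -> R -> X) (P : X -> Prop) x t : 0 <= t <= 1 ->
  (forall s, 0 <= s <= 1 -> P (h x s)) -> (forall s, 0 <= s <= 1 -> P (k x s)) ->
  P (concat h k x t).
Proof.
move=> t01 Ph Pk; rewrite /concat; case: (lerP t 2^-1) => ht.
  by apply: Ph; lra.
by apply: Pk; lra.
Qed.

Lemma continuous_affine (a b : R) : continuous (fun t : R => a * t + b).
Proof. by move=> t; apply: cvgD; [exact: mulrl_continuous|exact: cvg_cst]. Qed.

Lemma homotopy_concat T X (D : set T) (h k : T -> R -> X) :
  homotopy D h -> homotopy D k -> (forall x, D x -> k x 0 = h x 1) ->
  homotopy D (concat h k).
Proof.
move=> hc kc k0.
pose L : set (T * R) := [set p | p.2 <= 2^-1].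
pose G : set (T * R) := [set p | 2^-1 <= p.2].
have cL : closed L.
  apply: (@closed_comp _ _ snd [set t : R | t <= 2^-1]) => [p _|].
    exact: cvg_snd.
  exact: closed_le.
have cG : closed G.
  apply: (@closed_comp _ _ snd [set t : R | 2^-1 <= t]) => [p _|].
    exact: cvg_snd.
  exact: closed_ge.
have aff (F : set (T * R)) (a b : R) :
    {within F, continuous (fun p : T * R => a * p.2 + b)}.
  apply: (@within_comp _ _ _ F setT snd (fun t => a * t + b)) => //.
    exact: within_snd.
  exact/continuous_subspaceT/continuous_affine.
apply: (within_closed_glue cL cG).
- by move=> -[x t] _; rewrite /L /G /=; case: (lerP t 2^-1) => [|/ltW]; [left|right].
- apply: (@within_eq _ _ _ (fun p : T * R => h p.1 (2 * p.2 + 0))).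
    by move=> -[x t] [_ /= tL]; rewrite /concat ifT// addr0.
  apply: (homotopy_within hc) => //; first exact: within_fst.
  move=> -[x t] [[/= Dx]]; rewrite in_itv /= /L /= => t01 tL.
  by split=> //; lra.
- apply: (@within_eq _ _ _ (fun p : T * R => k p.1 (2 * p.2 + (- 1)))).
    move=> -[x t] [[/= Dx _] /= tG]; rewrite /concat; case: lerP => // tL.
    have -> : t = 2^-1 by apply/le_anti; rewrite tL.
    by rewrite divff// subrr k0.
  apply: (homotopy_within kc) => //; first exact: within_fst.
  move=> -[x t] [[/= Dx]]; rewrite in_itv /= /G /= => t01 tG.
  by split=> //; lra.
Qed.

(** Running k only up to time chi x extends it by the map f from which it
    starts, wherever chi vanishes. *)
Definition cutoff T X (f : T -> X) (k : T -> R -> X) (chi : T -> R) (x : T)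
    (t : R) : X :=
  if chi x == 0 then f x else k x (t * chi x).

Lemma cutoffE T X (f : T -> X) (k : T -> R -> X) (chi : T -> R) x :
  k x 0 = f x -> cutoff f k chi x = (fun t => k x (t * chi x)).
Proof.
by move=> k0; apply/funext => t; rewrite /cutoff; case: eqP => // ->; rewrite mulr0.
Qed.

Lemma cutoff_off T X (f : T -> X) (k : T -> R -> X) (chi : T -> R) x :
  chi x = 0 -> cutoff f k chi x = fun=> f x.
Proof. by move=> chi0; apply/funext => t; rewrite /cutoff chi0 eqxx. Qed.

Lemma cutoff0 T X (f : T -> X) (k : T -> R -> X) (chi : T -> R) x :
  chi x = 0 \/ k x 0 = f x -> cutoff f k chi x 0 = f x.
Proof. by move=> [/cutoff_off ->//|k0]; rewrite cutoffE// mul0r. Qed.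

Lemma cutoff_on T X (f : T -> X) (k : T -> R -> X) (chi : T -> R) x :
  chi x = 1 -> cutoff f k chi x = k x.
Proof.
by move=> chi1; apply/funext => t; rewrite /cutoff chi1 oner_eq0 mulr1.
Qed.

(** As k has to be defined on D only, chi must vanish near the points of E
    outside D, and not just at them. *)
Lemma homotopy_cutoff T X (D E : set T) (f : T -> X) (k : T -> R -> X)
    (chi : T -> R) : open D -> homotopy D k -> (forall x, D x -> k x 0 = f x) ->
  {within E, continuous f} -> continuous chi -> (forall x, 0 <= chi x <= 1) ->
  (forall x, E x -> ~ D x -> \forall y \near x, chi y = 0) ->
  homotopy E (cutoff f k chi).
Proof.
move=> oD kc k0 fc chic chi01 off; apply/within_nbhsP => -[x t] [/= Ex].
rewrite in_itv /= => t01 W Wx; have [Dx|nDx] := pselect (D x); last first.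
  have xE : cutoff f k chi x t = f x.
    by rewrite cutoff_off //; exact: nbhs_singleton (off x Ex nDx).
  rewrite xE in Wx; move/within_nbhsP: fc => /(_ x Ex W Wx) fc.
  exists ([set y | chi y = 0 /\ (E y -> W (f y))], setT) => /=.
    split; last exact: filterT.
    by apply: filterS2 (off x Ex nDx) fc => y.
  by move=> [y s] [/= [cy Wy] _] [/= /Wy ? _]; rewrite cutoff_off.
pose g (p : T * R) := k p.1 (p.2 * chi p.1).
have gc : {within D `*` `[0, 1], continuous g}.
  apply: (homotopy_within kc); first exact: within_fst.
    apply: continuous_subspaceT => p; apply: cvgM; first exact: cvg_snd.
    by apply: (@continuous_comp _ _ _ fst chi); [exact: cvg_fst|exact: chic].
  move=> [y s] [/= Dy]; rewrite in_itv /= => s01; split=> //.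
  by have := chi01 y; nra.
move/within_nbhsP: gc => /(_ (x, t)); rewrite /g /= => /(_ _ W).
rewrite (cutoffE chi (k0 x Dx)) in Wx => /(_ _ Wx) gc.
have xt : (D `*` `[0, 1]%classic) (x, t) by split=> //=; rewrite in_itv.
have nD : \forall p \near (x, t), D p.1.
  exists (D, setT) => /=; last by move=> [y s] [].
  by split; [apply: open_nbhs_nbhs|exact: filterT].
apply: filterS2 (gc xt) nD => -[y s] /= gy Dy [_ s01].
by rewrite cutoffE; [exact: gy|exact: k0].
Qed.

(** The tube lemma, by compactness of the unit interval. *)
Lemma near_forall_unit T (P : T -> R -> Prop) (x : T) :
  (forall t : R, 0 <= t <= 1 ->
    \forall p \near (x, t), 0 <= p.2 <= 1 -> P p.1 p.2) ->
  \forall y \near x, forall t : R, 0 <= t <= 1 -> P y t.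
Proof.
move=> Px.
suff : \forall y \near x, `[0, 1] `<=` [set t : R | 0 <= t <= 1 -> P y t].
  by apply: filterS => y Qy t t01; apply: Qy; rewrite /= ?in_itv.
have /compact_near_coveringP := @segment_compact R 0 1.
apply=> t; rewrite /= in_itv /= => /Px [[A B] /= [xA tB] AB].
by exists (B, A) => // -[s y] /= [Bs Ay]; exact: (AB (y, s)).
Qed.

End Homotopies.

(** * Line integrals *)

Section Interval.
Context {R : realType}.

(** A form of the Lebesgue number lemma, for a relation between the ends of short
    intervals. *)
Lemma lebesgue_number_itv (a b : R) (P : R -> R -> Prop) :
  (forall t, a <= t <= b -> \forall p \near (t, t),
     a <= p.1 <= b -> a <= p.2 <= b -> P p.1 p.2) ->
  exists n : nat, forall s s', a <= s <= b -> a <= s' <= b ->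
    s <= s' <= s + n.+1%:R^-1 -> P s s'.
Proof.
move=> Ploc.
pose Q (n : nat) (s : R) := a <= s <= b -> forall s', a <= s' <= b ->
  s <= s' <= s + n.+1%:R^-1 -> P s s'.
suff [n _ /(_ n (leqnn n)) nP] : \forall n \near \oo, `[a, b] `<=` Q n.
  by exists n => s s' sab; apply: nP => //=; rewrite in_itv.
have /compact_near_coveringP := @segment_compact R a b.
suff near_t (t : R) : a <= t <= b -> \forall s \near t & n \near \oo, Q n s.
  by apply=> t; rewrite /= in_itv /=; exact: near_t.
move=> /Ploc [[V W] /= [tV tW] VW].
have [e /= e0 eVW] : nbhs t (V `&` W) by apply: filterI.
have e2 : 0 < e / 2 by lra.
exists (ball t (e / 2), [set n : nat | (n.+1%:R^-1 < e / 2 :> R)]) => /=.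
  split; first exact: nbhsx_ballx.
  exact: (near_infty_natSinv_lt (PosNum e2)).
move=> [s n] /= []; rewrite /ball /= => ts ne sab s' s'ab ss'.
apply: (VW (s, s')) => //=; split.
  by apply: (eVW s _).1; rewrite /= (lt_trans ts)//; lra.
apply: (eVW s' _).2 => /=; rewrite ltr_norml; move: ts; rewrite ltr_norml.
by move: ne ss'; set m := _^-1; lra.
Qed.

(** The nearest point to s in the interval from a to b. *)
Definition clip (a b s : R) : R := Num.max a (Num.min s b).

Lemma clip_cases (a b s : R) : a <= b ->
  [\/ s <= a /\ clip a b s = a, a <= s <= b /\ clip a b s = s
    | b <= s /\ clip a b s = b].
Proof.
move=> ab; rewrite /clip; case: (lerP s b) => sb; last first.
  by constructor 3; rewrite (ltW sb); split=> //; apply/max_idPr.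
case: (lerP s a) => sa; first by constructor 1.
by constructor 2; rewrite (ltW sa).
Qed.

Lemma clip_bounds (a b s : R) : a <= b -> a <= clip a b s <= b.
Proof. by move=> ab; have [] := clip_cases s ab; move=> [? ->]; lra. Qed.

Lemma continuous_clip (a b : R) : continuous (clip a b).
Proof.
move=> s; apply: (@continuous_max _ _ (fun=> a) (id \min (fun=> b))).
  exact: cvg_cst.
apply: (@continuous_min _ _ id (fun=> b)); first exact: cvg_id.
exact: cvg_cst.
Qed.

(** Stopping s in every interval of a partition splits an increment of phi into
    its parts over these intervals. *)
Lemma sum_clip (phi : R -> R) (t : nat -> R) (n : nat) (s : R) :
  (forall i, (i < n)%N -> t i < t i.+1) ->
  \sum_(0 <= i < n) (phi (clip (t i) (t i.+1) s) - phi (t i)) =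
  phi (clip (t 0%N) (t n) s) - phi (t 0%N).
Proof.
move=> tlt; have t0 j : (j <= n)%N -> t 0%N <= t j.
  elim: j => // j IH jn; apply: le_trans (IH (ltnW jn)) (ltW (tlt j jn)).
elim: n tlt t0 => [|n IH] tlt t0.
  rewrite big_geq//; have /le_anti <- : t 0%N <= clip (t 0%N) (t 0%N) s <= t 0%N.
    exact: clip_bounds.
  by rewrite subrr.
rewrite big_nat_recr//= IH; last 2 first.
- by move=> i /ltnW; exact: tlt.
- by move=> j /leqW; exact: t0.
have tn := tlt n (ltnSn n); have t0n := t0 n (leqnSn n).
have t0n1 := t0 n.+1 (leqnn _).
rewrite /clip; case: (lerP s (t n)) => sn.
  rewrite (min_idPl (le_trans sn (ltW tn))) (max_idPl sn); lra.
rewrite (max_idPr t0n); have sn' : t n <= Num.min s (t n.+1).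
  by rewrite le_min !ltW.
by rewrite (max_idPr sn') (max_idPr (le_trans t0n sn')); lra.
Qed.

Lemma locally_constant_itv (a b : R) (G : R -> R) : a <= b ->
  (forall t, a <= t <= b -> \forall s \near t, a <= s <= b -> G s = G t) ->
  G b = G a.
Proof.
move=> ab Gloc.
have [|n nP] := @lebesgue_number_itv a b (fun s s' => G s = G s').
  move=> t tab; have [e /= e0 eG] := Gloc t tab.
  exists (ball t e, ball t e); first by split; exact: nbhsx_ballx.
  by move=> [s s'] /= [ts ts'] sab s'ab; rewrite eG// eG.
(* steps of length 1/(n+1), stopped at b, which is reached after finitely many
   of them whatever the length of the interval *)
pose x i := Num.min b (a + i%:R * n.+1%:R^-1).
have n0 : 0 < n.+1%:R^-1 :> R by rewrite invr_gt0 ltr0n.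
have xG i : a <= x i <= b /\ G (x i) = G a.
  elim: i => [|i [xab <-]].
    by rewrite /x mul0r addr0 (min_idPr ab) lexx ab.
  have iS : i.+1%:R * n.+1%:R^-1 = i%:R * n.+1%:R^-1 + n.+1%:R^-1 :> R.
    by rewrite -natr1 mulrDl mul1r.
  have xS : a <= x i.+1 <= b /\ x i <= x i.+1 <= x i + n.+1%:R^-1.
    move: xab n0; rewrite /x iS; set d := _^-1; set y := _ * d.
    by case: (lerP b (a + y)); case: (lerP b (a + (y + d))); lra.
  by split; [case: xS|apply/esym/nP; case: xS].
have [i ib] : exists i, b = x i.
  exists (Num.truncn ((b - a) * n.+1%:R)).+1; apply/esym/min_idPl.
  by rewrite -lerBlDl ler_pdivlMr ?ltr0n//; exact/ltW/truncnS_gt.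
by rewrite {1}ib (xG i).2.
Qed.

End Interval.

Section LineIntegral.
Context {R : realType} {X : topologicalType}.
Implicit Types (w : closed_form R X) (g : R -> X) (F : R -> R).

(** Unlike sums over partitions, primitives restrict, glue and reparametrize
    pointwise, and they are determined up to a constant. *)
Definition primitive w g F := forall t, 0 <= t <= 1 ->
  forall U, form_cover w U -> U (g t) -> \forall s \near t, 0 <= s <= 1 ->
  F s - F t = form_fun w U (g s) - form_fun w U (g t).

Definition subordinate w g (n : nat) (t : nat -> R) (U : nat -> set X) :=
  forall i, (i < n)%N ->
    form_cover w (U i) /\ forall s, t i <= s <= t i.+1 -> U i (g s).

Lemma form_coverP w x : exists2 U, form_cover w U & U x.
Proof. by have : [set: X] x by []; rewrite -(form_coverT w) => -[U]; exists U. Qed.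

Lemma near_path g (V : set X) t : {within `[0, 1], continuous g} ->
  0 <= t <= 1 -> nbhs (g t) V -> \forall s \near t, 0 <= s <= 1 -> V (g s).
Proof.
move=> /within_nbhsP gc t01 /(gc t); rewrite /= in_itv /= => /(_ t01).
by apply: filterS => s; rewrite in_itv.
Qed.

Lemma partition_exists w g c : {within `[0, 1], continuous g} -> 0 <= c <= 1 ->
  exists n t U, [/\ t 0%N = 0, t n = c, forall i, (i < n)%N -> (t i < t i.+1 :> R)
    & subordinate w g n t U].
Proof.
move=> gc c01; have [c0|c0] := eqVneq c 0.
  by exists 0%N, (fun=> 0), (fun=> setT).
have [|n nP] := @lebesgue_number_itv R 0 1 (fun s s' => exists2 U,
  form_cover w U & forall u, s <= u <= s' -> U (g u)).
  move=> t t01; have [U wU Ut] := form_coverP w (g t).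
  have : nbhs (g t) U by apply: open_nbhs_nbhs; split=> //; exact: form_cover_open wU.
  move=> /(near_path gc t01) [e /= e0 eU].
  exists (ball t e, ball t e); first by split; exact: nbhsx_ballx.
  move=> [s s'] /= []; rewrite /ball /= => ts ts' s01 s'01; exists U => // u su.
  apply: eU; last by lra.
  by move: ts ts'; rewrite /= !ltr_norml; lra.
have [d dE] : exists d : R, d = n.+1%:R^-1 by eexists.
have d0 : 0 < d by rewrite dE invr_gt0 ltr0n.
have cpos : 0 < c by lra.
pose t i := c * (i%:R * d).
have tS i : t i.+1 = t i + c * d by rewrite /t -natr1 mulrDl mul1r mulrDr.
have tc i : (i <= n.+1)%N -> 0 <= t i <= c.
  move=> ile; have : i%:R * d <= 1.
    by rewrite dE ler_pdivrMr ?ltr0n// mul1r ler_nat.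
  have : 0 <= i%:R * d by rewrite mulr_ge0// ltW.
  by rewrite /t; move: (i%:R * d) => y y0 y1; nra.
have U_ i : exists U, (i < n.+1)%N ->
    form_cover w U /\ forall s, t i <= s <= t i.+1 -> U (g s).
  case: (ltnP i n.+1) => [ilt|_]; last by exists setT.
  have := tc i (ltnW ilt); have := tc i.+1 ilt; have := tS i.
  have cd0 : 0 < c * d by nra.
  have cd1 : c * d <= d by nra.
  move=> tSi t1 t2; have [|||U wU Ug] := nP (t i) (t i.+1); rewrite -?dE; try lra.
  by exists U.
have [U UP] := choice U_.
exists n.+1, t, U; split=> //.
- by rewrite /t mul0r mulr0.
- by rewrite /t dE divff ?mulr1// pnatr_eq0.
- by move=> i _; rewrite tS; nra.
Qed.

Lemma partition_le (n : nat) (t : nat -> R) (i j : nat) :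
  (forall i, (i < n)%N -> t i < t i.+1) -> (i <= j <= n)%N -> t i <= t j.
Proof.
move=> tlt /andP[ij]; rewrite -(subnKC ij); elim: (j - i)%N => [|k IH].
  by rewrite addn0.
by rewrite addnS => kn; apply: le_trans (IH (ltnW kn)) (ltW (tlt _ kn)).
Qed.


(** On each interval of the partition, the primitive and the local function differ
    by a constant, so the sum telescopes. *)
Lemma primitive_partition w g F n (t : nat -> R) U : primitive w g F ->
  (forall i, (i < n)%N -> t i < t i.+1) -> 0 <= t 0%N -> t n <= 1 ->
  subordinate w g n t U ->
  \sum_(0 <= i < n) (form_fun w (U i) (g (t i.+1)) -
                     form_fun w (U i) (g (t i))) = F (t n) - F (t 0%N).
Proof.
move=> Fp tlt t0 tn sub; rewrite -(telescope_sumr (F \o t))//.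
apply: eq_big_nat => i /andP[_ ilt] /=; have [wU Ug] := sub i ilt.
have ti0 : t 0%N <= t i by apply: (partition_le tlt); rewrite /= ltnW.
have tin : t i.+1 <= t n by apply: (partition_le tlt); rewrite ilt leqnn.
have := @locally_constant_itv R (t i) (t i.+1)
  (fun s => F s - form_fun w (U i) (g s)) (ltW (tlt i ilt)).
suff loc s : t i <= s <= t i.+1 -> \forall u \near s, t i <= u <= t i.+1 ->
    F u - form_fun w (U i) (g u) = F s - form_fun w (U i) (g s).
  by move=> /(_ loc); lra.
move=> si; have s01 : 0 <= s <= 1 by lra.
apply: filterS (Fp s s01 _ wU (Ug s si)) => u Fu ui.
have /Fu : 0 <= u <= 1 by lra.
by lra.
Qed.

(** This makes the line integral independent of the partition. *)
Lemma line_integral_primitive w g F c : {within `[0, 1], continuous g} ->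
  primitive w g F -> 0 <= c <= 1 -> line_integral w g 0 c = F c - F 0.
Proof.
move=> gc Fp c01; apply: xget_unique.
  have [n [t [U [t0 tn tlt sub]]]] := partition_exists w gc c01.
  exists n, t, U; split=> // [i ilt|].
    have [wU Ug] := sub i ilt; split=> // _ [s /= si <-]; apply: Ug.
    by move: si; rewrite in_itv.
  by rewrite (primitive_partition Fp tlt)// ?t0 ?tn//; lra.
move=> _ [n [t [U [t0 tn tlt sub ->]]]]; rewrite (primitive_partition Fp tlt).
- by rewrite t0 tn.
- by rewrite t0.
- by rewrite tn; lra.
- move=> i ilt; have [wU Ug] := sub i ilt; split=> // s si.
  by apply: Ug; exists s => //=; rewrite in_itv.
Qed.

(** The integral up to time s, computed with the local functions of one partition
    of the whole interval. *)
Definition clip_sum w g n (t : nat -> R) (U : nat -> set X) (s : R) : R :=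
  \sum_(0 <= i < n) (form_fun w (U i) (g (clip (t i) (t i.+1) s)) -
                     form_fun w (U i) (g (t i))).

(** Near a time s, all local functions of the partition may be replaced by one
    whose domain contains g s, and then the sum telescopes. *)
Lemma primitive_clip_sum w g n (t : nat -> R) U : {within `[0, 1], continuous g} ->
  t 0%N = 0 -> t n = 1 -> (forall i, (i < n)%N -> t i < t i.+1) ->
  subordinate w g n t U -> primitive w g (clip_sum w g n t U).
Proof.
move=> gc t0 tn tlt sub s s01 V wV Vs.
have t01 i : (i <= n)%N -> 0 <= t i <= 1.
  by move=> ile; rewrite -{1}t0 -tn !(partition_le tlt)// ?ile ?leqnn.
have loc (i : 'I_n) : \forall u \near s, 0 <= u <= 1 ->
    form_fun w (U i) (g (clip (t i) (t i.+1) u)) -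
    form_fun w (U i) (g (clip (t i) (t i.+1) s)) =
    form_fun w V (g (clip (t i) (t i.+1) u)) -
    form_fun w V (g (clip (t i) (t i.+1) s)).
  have [wU Ug] := sub i (ltn_ord i); have ti := ltW (tlt i (ltn_ord i)).
  have ti0 := t01 i (ltnW (ltn_ord i)); have ti1 := t01 i.+1 (ltn_ord i).
  have out x : (\forall u \near s, clip (t i) (t i.+1) u = x) ->
      \forall u \near s, 0 <= u <= 1 ->
      form_fun w (U i) (g (clip (t i) (t i.+1) u)) -
      form_fun w (U i) (g (clip (t i) (t i.+1) s)) =
      form_fun w V (g (clip (t i) (t i.+1) u)) -
      form_fun w V (g (clip (t i) (t i.+1) s)).
    move=> ux; have /= xE := nbhs_singleton ux; apply: filterS ux => u -> _.
    by rewrite xE !subrr.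
  have [si|si] := ltP s (t i).
    apply: (out (t i)); apply: filterS (lt_nbhsl si) => u ui.
    by rewrite /clip max_l// ge_min (ltW ui).
  have [ti_s|s_ti] := ltP (t i.+1) s.
    apply: (out (t i.+1)); apply: filterS (lt_nbhsr ti_s) => u ui.
    by rewrite /clip min_r ?max_r// (ltW ui).
  have cs : clip (t i) (t i.+1) s = s by rewrite /clip min_l ?max_r.
  have : \forall x \near g s, (V `&` U i) x ->
      form_fun w V x - form_fun w (U i) x =
      form_fun w V (g s) - form_fun w (U i) (g s).
    by apply: form_fun_closed => //; split=> //; apply: Ug; rewrite si.
  have nV : nbhs (g s) V.
    by apply: open_nbhs_nbhs; split=> //; exact: form_cover_open wV.
  move=> nE; have := @continuous_clip R (t i) (t i.+1) s.
  rewrite /continuous_at cs => cc.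
  have cE : nbhs s _ := cc _ (near_path gc s01 nE).
  have cV : nbhs s _ := cc _ (near_path gc s01 nV).
  apply: filterS2 cE cV => u /= uE uV _; have ub := clip_bounds u ti.
  have u01' : 0 <= clip (t i) (t i.+1) u <= 1 by lra.
  have := uE u01' (conj (uV u01') (Ug _ ub)); lra.
apply: filterS (filter_forall _ loc) => u uloc u01; rewrite /clip_sum -sumrB.
transitivity (\sum_(0 <= i < n)
    (form_fun w V (g (clip (t i) (t i.+1) u)) - form_fun w V (g (t i)) -
    (form_fun w V (g (clip (t i) (t i.+1) s)) - form_fun w V (g (t i))))).
  rewrite !big_mkord; apply: eq_bigr => i _; have := uloc i u01; lra.
rewrite sumrB !(sum_clip (form_fun w V \o g))// t0 tn /=.
have cE v : 0 <= v <= 1 -> clip 0 1 v = v.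
  by move=> v01; rewrite /clip min_l ?max_r; lra.
by rewrite !cE//; lra.
Qed.


Lemma primitive_exists w g : {within `[0, 1], continuous g} ->
  exists F, primitive w g F.
Proof.
move=> gc; have [|n [t [U [t0 tn tlt sub]]]] := @partition_exists w g 1 gc.
  by rewrite ler01 lexx.
by exists (clip_sum w g n t U); exact: primitive_clip_sum.
Qed.

Lemma primitive_line_integral w g : {within `[0, 1], continuous g} ->
  primitive w g (line_integral w g 0).
Proof.
move=> gc; have [F Fp] := primitive_exists w gc => t t01 U wU Ut.
apply: filterS (Fp t t01 U wU Ut) => s Fs s01; rewrite -Fs//.
by rewrite !(line_integral_primitive gc Fp)//; lra.
Qed.

Lemma line_integral0 w g : line_integral w g 0 0 = 0.
Proof.
apply: xget_unique => [|_ [n [t [U [t0 tn tlt _ ->]]]]].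
  by exists 0%N, (fun=> 0), (fun=> setT); split=> //; rewrite big_geq.
case: n tn tlt => [|n] tn tlt; first by rewrite big_geq.
have := @partition_le n.+1 t 1 n.+1 tlt (leqnn _); have := tlt 0%N isT; lra.
Qed.

Lemma primitive_comp w g F (tau : R -> R) : {within `[0, 1], continuous g} ->
  primitive w g F -> continuous tau ->
  (forall t, 0 <= t <= 1 -> 0 <= tau t <= 1) -> primitive w (g \o tau) (F \o tau).
Proof.
move=> gc Fp tauc tau01 t t01 U wU Ut.
have nF : nbhs t _ := tauc t _ (Fp _ (tau01 t t01) U wU Ut).
apply: filterS nF => s Fs s01 /=.
by apply: Fs; exact: tau01.
Qed.

Lemma line_integral_scale w g (c t : R) : {within `[0, 1], continuous g} ->
  0 <= c <= 1 -> 0 <= t <= 1 ->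
  line_integral w (fun s => g (s * c)) 0 t = line_integral w g 0 (t * c).
Proof.
move=> gc c01 t01; pose tau s : R := s * c.
have tauc : continuous tau by exact: mulrr_continuous.
have tau01 s : 0 <= s <= 1 -> 0 <= tau s <= 1 by rewrite /tau => s01; nra.
have Fp := primitive_comp gc (primitive_line_integral (w := w) gc) tauc tau01.
rewrite (line_integral_primitive (g := g \o tau) _ Fp)//.
  by rewrite /= /tau mul0r line_integral0 subr0.
apply: (within_comp _ gc); first exact: continuous_subspaceT.
by move=> s; rewrite /= !in_itv /=; exact: tau01.
Qed.

Lemma line_integral_eq w g g' c : 0 <= c ->
  (forall s, 0 <= s <= c -> g s = g' s) ->
  line_integral w g 0 c = line_integral w g' 0 c.
Proof.
move=> c0.
suff imp (f f' : R -> X) v : (forall s, 0 <= s <= c -> f s = f' s) ->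
    is_line_integral w f 0 c v -> is_line_integral w f' 0 c v.
  move=> gg'; rewrite /line_integral; congr (xget 0 _).
  by apply/seteqP; split=> v /=; apply: imp => // s sc; rewrite gg'.
move=> ff' [n [t [U [t0 tn tlt sub vE]]]]; exists n, t, U.
have tc i : (i <= n)%N -> 0 <= t i <= c.
  by move=> ile; rewrite -{1}t0 -tn !(partition_le tlt)// ?ile ?leqnn.
split=> // [i ilt|].
  have [wU fU] := sub i ilt; split=> // _ [s /= si <-]; apply: fU.
  exists s => //; rewrite ff'//; have := tc i (ltnW ilt); have := tc i.+1 ilt.
  by move: si; rewrite in_itv /=; lra.
rewrite vE; apply: eq_big_nat => i /andP[_ ilt].
by rewrite !ff' ?tc// ltnW.
Qed.

(** The two motions are traversed one after the other, each being stopped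
    while the other one runs. *)
Lemma primitive_concat w (S : topologicalType) (h k : S -> R -> X) x F G :
  {within `[0, 1], continuous (h x)} -> {within `[0, 1], continuous (k x)} ->
  k x 0 = h x 1 -> primitive w (h x) F -> primitive w (k x) G ->
  primitive w (concat h k x)
    (fun t => F (Num.min (2 * t) 1) + G (Num.max (2 * t - 1) 0)).
Proof.
set y := h x 1 => hc kc k0 Fp Gp t t01 U wU Ut.
pose a s : R := Num.min (2 * s) 1; pose b s : R := Num.max (2 * s - 1) 0.
have ac : continuous a.
  move=> s; apply: (@continuous_min R R (fun r => 2 * r) (fun=> 1) s).
    exact: mulrl_continuous.
  exact: cvg_cst.
have bc : continuous b.
  move=> s; apply: (@continuous_max R R (fun r => 2 * r - 1) (fun=> 0) s).
    exact: continuous_affine.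
  exact: cvg_cst.
have a01 s : 0 <= s <= 1 -> 0 <= a s <= 1 by rewrite /a; case: (lerP (2 * s) 1); lra.
have b01 s : 0 <= s <= 1 -> 0 <= b s <= 1 by rewrite /b; case: (lerP (2 * s - 1) 0); lra.
have Fa := primitive_comp hc Fp ac a01; have Gb := primitive_comp kc Gp bc b01.
have abE s : form_fun w U (h x (a s)) + form_fun w U (k x (b s)) =
    form_fun w U (concat h k x s) + form_fun w U y.
  rewrite /concat /a /b; case: (lerP s 2^-1) => s2.
    have -> : Num.min (2 * s) 1 = 2 * s by apply/min_idPl; lra.
    have -> : Num.max (2 * s - 1) 0 = 0 by apply/max_idPr; lra.
    by rewrite k0.
  have -> : Num.min (2 * s) 1 = 1 by apply/min_idPr; lra.
  have -> : Num.max (2 * s - 1) 0 = 2 * s - 1 by apply/max_idPl; lra.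
  by rewrite addrC.
have nF : \forall s \near t, 0 <= s <= 1 -> F (a s) - F (a t) =
    form_fun w U (h x (a s)) - form_fun w U (h x (a t)).
  have [t2|t2] := leP t 2^-1.
    apply: Fa => //=; move: Ut; rewrite /concat t2 /a min_l//; lra.
  apply: filterS (lt_nbhsr t2) => s s2 _.
  have aE r : 2^-1 < r -> a r = 1 by move=> r2; rewrite /a min_r//; lra.
  by rewrite !aE// !subrr.
have nG : \forall s \near t, 0 <= s <= 1 -> G (b s) - G (b t) =
    form_fun w U (k x (b s)) - form_fun w U (k x (b t)).
  have [t2|t2] := ltP t 2^-1.
    apply: filterS (lt_nbhsl t2) => s s2 _.
    have bE r : r < 2^-1 -> b r = 0 by move=> r2; rewrite /b max_r//; lra.
    by rewrite !bE// !subrr.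
  apply: Gb => //=; move: Ut; rewrite /concat /b max_l ?subr_ge0; last by lra.
  case: lerP => // t2' ; have -> : t = 2^-1 by apply/le_anti; rewrite t2 t2'.
  by rewrite divff// subrr k0.
apply: filterS2 nF nG => s /[swap] sG /[swap] s01.
move=> /(_ s01); have := sG s01; have := abE s; have := abE t.
rewrite -/(a s) -/(a t) -/(b s) -/(b t); lra.
Qed.

(** Both terms stay meaningful for all t: before half time the second integral is
    over a point, and after it the first one is complete. *)
Lemma line_integral_concat w (S : topologicalType) (D : set S)
    (h k : S -> R -> X) x (t : R) :
  homotopy D h -> homotopy D k -> (forall x, D x -> k x 0 = h x 1) -> D x ->
  0 <= t <= 1 ->
  line_integral w (concat h k x) 0 t =
  line_integral w (h x) 0 (Num.min (2 * t) 1) +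
  line_integral w (k x) 0 (Num.max (2 * t - 1) 0).
Proof.
move=> hc kc k0 Dx t01.
have hxc := homotopy_path hc Dx; have kxc := homotopy_path kc Dx.
have p := primitive_concat hxc kxc (k0 _ Dx)
  (primitive_line_integral (w := w) hxc) (primitive_line_integral (w := w) kxc).
have cc := homotopy_path (homotopy_concat hc kc k0) Dx.
rewrite (line_integral_primitive cc p t01) mulr0 sub0r.
have -> : Num.min 0 1 = 0 :> R by apply/min_idPl; lra.
have -> : Num.max (-1) 0 = 0 :> R by apply/max_idPr; lra.
by rewrite !line_integral0 addr0 subr0.
Qed.

Lemma line_integral_concat1 w (S : topologicalType) (D : set S)
    (h k : S -> R -> X) x :
  homotopy D h -> homotopy D k -> (forall x, D x -> k x 0 = h x 1) -> D x ->
  line_integral w (concat h k x) 0 1 =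
  line_integral w (h x) 0 1 + line_integral w (k x) 0 1.
Proof.
move=> hc kc k0 Dx.
rewrite (line_integral_concat w hc kc k0 Dx) ?ler01 ?lexx// mulr1.
have -> : Num.min 2 1 = 1 :> R by apply/min_idPr; lra.
have -> : Num.max (2 - 1) 0 = 2 - 1 :> R by apply/max_idPl; lra.
by have -> : 2 - 1 = 1 :> R by lra.
Qed.

Lemma line_integral_concat_le w (S : topologicalType) (D : set S)
    (h k : S -> R -> X) x (t c d : R) :
  homotopy D h -> homotopy D k -> (forall x, D x -> k x 0 = h x 1) -> D x ->
  0 <= t <= 1 ->
  (forall s, 0 <= s <= 1 -> line_integral w (h x) 0 s <= c) ->
  (forall s, 0 <= s <= 1 -> line_integral w (k x) 0 s <= d) ->
  line_integral w (concat h k x) 0 t <= c + d.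
Proof.
move=> hc kc k0 Dx t01 hle kle.
rewrite (line_integral_concat w hc kc k0 Dx t01); apply: lerD.
  by apply: hle; case: (lerP (2 * t) 1); lra.
by apply: kle; case: (lerP (2 * t - 1) 0); lra.
Qed.

Lemma line_integral_cst w (x : X) (c : R) : 0 <= c <= 1 ->
  line_integral w (fun=> x) 0 c = 0.
Proof.
move=> c01; rewrite (line_integral_primitive (F := fun=> 0)) ?subrr//.
  by apply: continuous_subspaceT => t; exact: cvg_cst.
by move=> t _ U _ _; apply: (@nearW _ (nbhs t)) => s _; rewrite !subrr.
Qed.

Lemma line_integral_cutoff_le w (S : topologicalType) (D : set S) (f : S -> X)
    (k : S -> R -> X) (chi : S -> R) x (t c : R) :
  homotopy D k -> (forall x, D x -> k x 0 = f x) -> 0 <= chi x <= 1 -> 0 <= c ->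
  chi x = 0 \/ D x -> 0 <= t <= 1 ->
  (D x -> forall s, 0 <= s <= 1 -> line_integral w (k x) 0 s <= c) ->
  line_integral w (cutoff f k chi x) 0 t <= c.
Proof.
move=> kc k0 chi01 c0 [chi0 t01 _|Dx t01 kle].
  by rewrite cutoff_off// line_integral_cst.
rewrite cutoffE ?k0// (line_integral_scale _ (homotopy_path kc Dx))//.
by apply: kle => //; nra.
Qed.

(** A partition subordinate to one path of the family is subordinate to all
    nearby paths, and then the integral is given by one finite sum. *)
Lemma line_integral_continuous w (S : topologicalType) (D : set S)
    (h : S -> R -> X) : homotopy D h ->
  {within D `*` `[0, 1],
    continuous (fun p : S * R => line_integral w (h p.1) 0 p.2)}.
Proof.
move=> hc; apply/within_nbhsP => -[x s] [/= Dx]; rewrite in_itv /= => s01.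
have [|n [t [U [t0 tn tlt sub]]]] :=
  partition_exists w (c := 1) (homotopy_path hc Dx); first by rewrite ler01 lexx.
have tle := partition_le tlt.
have t01 i : (i <= n)%N -> 0 <= t i <= 1.
  by move=> ile; rewrite -{1}t0 -tn !tle// ?ile ?leqnn.
pose E := [set y | D y /\ subordinate w (h y) n t U].
have nE : \forall y \near x, D y -> E y.
  suff : \forall y \near x, forall u : R, 0 <= u <= 1 ->
      D y -> forall i : 'I_n, t i <= u <= t i.+1 -> U i (h y u).
    apply: filterS => y Uy Dy; split=> // i ilt.
    have [wU _] := sub i ilt; split=> // u ui.
    apply: (Uy u _ Dy (Ordinal ilt)) => //.
    have := t01 i (ltnW ilt); have := t01 i.+1 ilt; lra.
  apply: near_forall_unit => u u01.
  have loc (i : 'I_n) : \forall p \near (x, u),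
      D p.1 -> 0 <= p.2 <= 1 -> t i <= p.2 <= t i.+1 -> U i (h p.1 p.2).
    have [wU Ui] := sub i (ltn_ord i).
    have [ui|nui] := pselect (t i <= u <= t i.+1).
      have nU : nbhs (h x u) (U i).
        apply: open_nbhs_nbhs; split; first exact: form_cover_open wU.
        exact: Ui.
      have xu : (D `*` `[0, 1]) (x, u) by split=> //=; rewrite in_itv.
      have /within_nbhsP/(_ (x, u) xu _ nU) := hc.
      by apply: filterS => -[y v] /= Uyv Dy v01 _; apply: Uyv; rewrite in_itv.
    have nI : nbhs u (~` `[t i, t i.+1]).
      apply: open_nbhs_nbhs; split; first exact/closed_openC/interval_closed.
      by rewrite /= in_itv.
    exists (setT, ~` `[t i, t i.+1]); first by split=> //; exact: filterT.
    by move=> [y v] /= [_]; rewrite in_itv.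
  apply: filterS (filter_forall _ loc) => -[y v] /= Uyv _ Dy i vi; apply: Uyv => //.
  have := t01 i (ltnW (ltn_ord i)); have := t01 i.+1 (ltn_ord i); lra.
have Ec : {within E `*` `[0, 1],
    continuous (fun p : S * R => clip_sum w (h p.1) n t U p.2)}.
  apply: (@within_eq _ _ _ (fun p : S * R => \sum_(i < n)
    (form_fun w (U i) (h p.1 (clip (t i) (t i.+1) p.2)) -
     form_fun w (U i) (h p.1 (t i))))).
    by move=> p _; rewrite /clip_sum big_mkord.
  apply: continuous_big => [|i _]; first exact: add_continuous.
  have ilt := ltn_ord i; have ti := ltW (tlt i ilt).
  have i0 := t01 i (ltnW ilt); have i1 := t01 i.+1 ilt.
  have Uc (c : R -> R) : continuous c -> (forall v, t i <= c v <= t i.+1) ->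
      {within E `*` `[0, 1],
        continuous (fun p : S * R => form_fun w (U i) (h p.1 (c p.2)))}.
    move=> cc ci; apply: (within_comp (E := U i) (g := form_fun w (U i))
      (f := fun p : S * R => h p.1 (c p.2))).
    - apply: (homotopy_within hc); first exact: within_fst.
        apply: continuous_subspaceT => p; apply: continuous_comp (cc _).
        exact: cvg_snd.
      by move=> [y v] [[/= Dy _] _]; split=> //; have := ci v; lra.
    - by apply: form_fun_continuous; exact: (sub i ilt).1.
    - by move=> [y v] [[/= _ subE] _]; exact: (subE i ilt).2.
  move=> p; apply: cvgB; last first.
    by apply: (Uc (fun=> t i)) => [u|u]; [exact: cvg_cst|rewrite lexx].
  by apply: Uc => [|u]; [exact: continuous_clip|exact: clip_bounds].
have Ex : E x by exact: nbhs_singleton nE Dx.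
have EE y v : E y -> 0 <= v <= 1 ->
    line_integral w (h y) 0 v = clip_sum w (h y) n t U v.
  move=> [Dy subE] v01; have yc := homotopy_path hc Dy.
  rewrite (line_integral_primitive yc (primitive_clip_sum yc t0 tn tlt subE))//.
  suff -> : clip_sum w (h y) n t U 0 = 0 by rewrite subr0.
  rewrite /clip_sum big_nat big1// => i /andP[_ ilt].
  have i0 := t01 i (ltnW ilt); have i1 := t01 i.+1 ilt.
  by rewrite /clip min_l ?max_l ?subrr//; lra.
move=> W; rewrite EE// => Wx.
have xs : (E `*` `[0, 1]) (x, s) by split=> //=; rewrite in_itv.
have /within_nbhsP/(_ (x, s) xs W Wx) := Ec.
have nE' : \forall p \near (x, s), D p.1 -> E p.1.
  by exists ([set y | D y -> E y], setT) => [|[y v] []//]; split=> //; exact: filterT.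
apply: filterS2 nE' => -[y v] /= DE WE [/DE Ey]; rewrite in_itv /= => v01.
by rewrite EE//; apply: WE; split=> //=; rewrite in_itv.
Qed.

End LineIntegral.

(** * Neighbourhood deformation retracts in finite cell complexes *)

Section Disc.
Context {R : realType} {n : nat}.
Implicit Types v : 'rV[R]_n.

(** The sum of squares which defines the disc, and which the norm of row vectors,
    a maximum, does not give. *)
Definition sqnorm v : R := \sum_(i < n) v 0 i ^+ 2.

Lemma sqnorm_ge0 v : 0 <= sqnorm v.
Proof. by apply: sumr_ge0 => i _; exact: sqr_ge0. Qed.

Lemma sqnormZ (c : R) v : sqnorm (c *: v) = c ^+ 2 * sqnorm v.
Proof. by rewrite /sqnorm mulr_sumr; apply: eq_bigr => i _; rewrite mxE exprMn. Qed.

Lemma sqnorm_eq0 v : sqnorm v = 0 -> v = 0.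
Proof.
move=> /eqP; rewrite psumr_eq0 => [|i _]; last exact: sqr_ge0.
move=> /allP v0; apply/rowP => i; rewrite mxE; apply/eqP.
by rewrite -[_ == _](sqrf_eq0 (v 0 i)); exact: v0 (mem_index_enum _).
Qed.

Lemma sqnorm_continuous : continuous sqnorm.
Proof.
apply: continuous_big => [|i _]; first exact: add_continuous.
move=> v; apply: (@continuous_comp _ _ _ (fun v : 'rV[R]_n => v 0 i) (fun x => x ^+ 2)).
  exact: coord_continuous.
exact: exprn_continuous.
Qed.

Lemma disc_sphere v : disc R n v -> open_disc R n v \/ sphere R n v.
Proof.
rewrite /disc /open_disc /sphere /= le_eqVlt => /predU1P[]; first by right.
by left.
Qed.

Lemma open_disc_disc : open_disc R n `<=` disc R n.
Proof. by move=> v; exact: ltW. Qed.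

Lemma sphere_disc : sphere R n `<=` disc R n.
Proof. by move=> v; rewrite /sphere /disc /= => ->. Qed.

Lemma disc_compact : compact (disc R n).
Proof.
apply: (@subclosed_compact _ _
    [set v : 'rV[R]_n | forall i, v ord0 i \in `[-1, 1]]).
- exact: (closed_comp (fun v _ => sqnorm_continuous (x := v)) (@closed_le R 1)).
- have := @rV_compact _ n (fun=> `[(-1 : R), 1]%classic).
  by apply=> _; exact: segment_compact.
move=> v; rewrite /disc /= => v1 i; rewrite in_itv /= -ler_norml.
rewrite -(@ler_sqr _ `|_|) ?nnegrE// expr1n real_normK ?num_real//.
apply: le_trans v1; rewrite (bigD1 i)//= lerDl.
by apply: sumr_ge0 => j _; exact: sqr_ge0.
Qed.

Lemma open_disc0 : open_disc R n 0.
Proof. by rewrite /open_disc /= big1 // => i _; rewrite mxE expr0n. Qed.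

Lemma disc_scale (c : R) v : 0 <= c <= 1 -> disc R n v -> disc R n (c *: v).
Proof.
rewrite /disc /= -!/(sqnorm _) sqnormZ => c01 v1.
have c2 : 0 <= c ^+ 2 <= 1 by nra.
by have := sqnorm_ge0 v; nra.
Qed.

Lemma open_disc_scale (c : R) v : 0 <= c < 1 -> disc R n v -> open_disc R n (c *: v).
Proof.
rewrite /disc /open_disc /= -!/(sqnorm _) sqnormZ => c01 v1.
have c2 : 0 <= c ^+ 2 < 1 by nra.
by have := sqnorm_ge0 v; nra.
Qed.

(** The point reached at time s when v moves along its ray to the sphere. *)
Definition stretch (v : 'rV[R]_n) (s : R) : 'rV[R]_n :=
  (1 - s + s / Num.sqrt (sqnorm v)) *: v.

Lemma stretch0 v : stretch v 0 = v.
Proof. by rewrite /stretch mul0r addr0 subr0 scale1r. Qed.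

Lemma stretch_sphere v s : sphere R n v -> stretch v s = v.
Proof.
rewrite /sphere /= -/(sqnorm v) /stretch => ->.
by rewrite sqrtr1 divr1 subrK scale1r.
Qed.

Lemma sqnorm_stretch v s : v != 0 ->
  sqnorm (stretch v s) = ((1 - s) * Num.sqrt (sqnorm v) + s) ^+ 2.
Proof.
move=> v0; have q0 : 0 < sqnorm v.
  by rewrite lt_neqAle sqnorm_ge0 andbT eq_sym; apply: contraNneq v0 => /sqnorm_eq0 ->.
rewrite sqnormZ -{2}(sqr_sqrtr (sqnorm_ge0 v)) -exprMn; congr (_ ^+ 2).
by field; rewrite gt_eqF// sqrtr_gt0.
Qed.

Lemma stretch_disc v s : v != 0 -> disc R n v -> 0 <= s <= 1 ->
  disc R n (stretch v s).
Proof.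
move=> v0; rewrite /disc /= -!/(sqnorm _) => v1 s01; rewrite sqnorm_stretch//.
have r0 := sqrtr_ge0 (sqnorm v).
have r1 : Num.sqrt (sqnorm v) <= 1 by rewrite -sqrtr1 ler_sqrt.
by rewrite -[leRHS](expr1n _ 2) ler_sqr ?nnegrE //; nra.
Qed.

Lemma stretch1_sphere v : v != 0 -> sphere R n (stretch v 1).
Proof.
move=> v0; rewrite /sphere /= -/(sqnorm _) sqnorm_stretch//.
by rewrite subrr mul0r add0r expr1n.
Qed.

Lemma stretch_continuous (D : set ('rV[R]_n * R)) :
  (forall p, D p -> p.1 != 0) ->
  {within D, continuous (fun p : 'rV[R]_n * R => stretch p.1 p.2)}.
Proof.
move=> D0; apply: continuous_in_subspaceT => p /set_mem /D0 p0.
have q0 : Num.sqrt (sqnorm p.1) != 0.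
  rewrite sqrtr_eq0 -ltNge lt_neqAle sqnorm_ge0 andbT eq_sym.
  by apply: contraNneq p0 => /sqnorm_eq0 ->.
apply: cvgZ; last exact: cvg_fst.
apply: cvgD; first by apply: cvgB; [exact: cvg_cst|exact: cvg_snd].
apply: cvgM; first exact: cvg_snd.
apply: cvgV => //.
apply: (@continuous_comp _ _ _ (fun p : 'rV[R]_n * R => sqnorm p.1) Num.sqrt).
  apply: (@continuous_comp _ _ _ fst sqnorm); first exact: cvg_fst.
  exact: sqnorm_continuous.
exact: sqrt_continuous.
Qed.

End Disc.

Lemma hausdorff_prod (S T : topologicalType) : hausdorff_space S ->
  hausdorff_space T -> hausdorff_space (S * T)%type.
Proof.
move=> hS hT [x y] [x' y'] pq; congr pair.
  apply: hS => P Q xP x'Q; have [] := pq (P `*` setT) (Q `*` setT).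
  - by exists (P, setT) => //; split=> //; exact: filterT.
  - by exists (Q, setT) => //; split=> //; exact: filterT.
  - by move=> [u v] [[/= Pu _] [/= Qu _]]; exists u.
apply: hT => P Q xP x'Q; have [] := pq (setT `*` P) (setT `*` Q).
- by exists (setT, P) => //; split=> //; exact: filterT.
- by exists (setT, Q) => //; split=> //; exact: filterT.
- by move=> [u v] [[/= _ Pu] [/= _ Qu]]; exists v.
Qed.

Section Cells.
Context {R : realType} {X : topologicalType} (K : finite_cw R X).
Implicit Types (e : cell K) (J : {set cell K}).

Local Notation chi e := (@char_map R X K e).

Let hX : hausdorff_space X := cw_hausdorff K.

Definition closed_cell e : set X := chi e @` disc R (cell_dim e).

Lemma closed_cell_compact e : compact (closed_cell e).
Proof.
apply: continuous_compact; last exact: disc_compact.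
exact: char_map_continuous.
Qed.

Lemma closed_cell_closed e : closed (closed_cell e).
Proof. by apply: compact_closed => //; exact: closed_cell_compact. Qed.

Lemma open_cell_closed_cell e : open_cell e `<=` closed_cell e.
Proof. by move=> _ [v /open_disc_disc vD <-]; exists v. Qed.

Lemma open_cell_inj e e' x : open_cell e x -> open_cell e' x -> e = e'.
Proof.
by move=> ex e'x; apply: (cells_disjoint (f := K)) => //; exists x.
Qed.

(** The open disc is dense in the disc. *)
Lemma closed_cell_sub_closed e (B : set X) : closed B -> open_cell e `<=` B ->
  closed_cell e `<=` B.
Proof.
move=> cB eB _ [v vD <-]; apply: contrapT => nBv.
have oB : nbhs (chi e v) (~` B).
  by apply: open_nbhs_nbhs; split=> //; exact: closed_openC.
have /within_nbhsP/(_ v vD _ oB) := char_map_continuous (f := K) (e := e).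
have scalec : {for (1 : R), continuous (fun c : R => c *: v)}.
  exact: (@scalel_continuous _ _ v 1).
rewrite -{1}[v]scale1r => /scalec [d /= d0 dB].
(* a factor in the interval from 0 to 1, excluding 1, at distance less than d
   from 1 *)
pose c := Num.max 0 (1 - d / 2).
have c01 : 0 <= c < 1 by rewrite /c; case: (lerP 0 (1 - d / 2)); lra.
apply: (dB c) => /=.
- rewrite ger0_norm ?subr_ge0 ?ltW; try lra.
  by rewrite /c; case: (lerP 0 (1 - d / 2)); lra.
- by apply: disc_scale => //; lra.
- by apply: eB; exists (c *: v) => //; exact: open_disc_scale.
Qed.

Definition cells_union J : set X := \bigcup_(e in [set` J]) open_cell e.

(** Then the union of the cells in J is closed, hence a subcomplex. *)
Definition boundary_closed J :=
  forall e, e \in J -> closed_cell e `<=` cells_union J.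

Lemma cells_union_closed J : boundary_closed J -> closed (cells_union J).
Proof.
move=> Jc; have -> : cells_union J = \bigcup_(e in [set` J]) closed_cell e.
  apply/seteqP; split=> [x [e eJ ex]|x [e eJ ex]]; last exact: Jc ex.
  by exists e => //; exact: open_cell_closed_cell.
apply: closed_bigcup => [|e _]; first exact: finite_finset.
exact: closed_cell_closed.
Qed.

Lemma cells_union_mem J e x : open_cell e x -> cells_union J x -> e \in J.
Proof. by move=> ex [e' e'J /(open_cell_inj ex) ->]. Qed.

Lemma cw_compact : compact [set: X].
Proof.
have -> : [set: X] = \big[setU/set0]_(e <- enum (cell K)) closed_cell e.
  apply/seteqP; split=> // x; rewrite -(cells_cover K) => -[e _ ex].
  rewrite -bigcup_seq; exists e; first by rewrite /= mem_enum.
  exact: open_cell_closed_cell.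
by apply: bigsetU_compact => e _; exact: closed_cell_compact.
Qed.

Section Push.
Context (e : cell K).

Definition center : X := chi e 0.

Definition cell_coord (x : X) : 'rV[R]_(cell_dim e) :=
  xget 0 [set v | open_disc R (cell_dim e) v /\ chi e v = x].

(** The radial motion of the punctured cell onto its boundary, extended by the
    identity outside the cell. *)
Definition push (x : X) (s : R) : X :=
  if `[< open_cell e x >] then chi e (stretch (cell_coord x) s) else x.

Lemma cell_coordK v : open_disc R (cell_dim e) v -> cell_coord (chi e v) = v.
Proof.
move=> vD; apply: xget_unique => // u [uD uv].
by apply: (char_map_inj (f := K) (e := e)) => //; exact/mem_set.
Qed.

Lemma open_cell_center : open_cell e center.
Proof. by exists 0 => //; exact: open_disc0. Qed.

Lemma sphere_not_open v : sphere R (cell_dim e) v -> ~ open_cell e (chi e v).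
Proof.
move=> vS ev; have [|e' /= e'e e'v] := @cell_boundary R X K e (chi e v).
  by exists v.
by move: e'e; rewrite (open_cell_inj ev e'v) ltnn.
Qed.

(** This holds on the sphere too, where both sides are stationary. So push is
    continuous along the characteristic map. *)
Lemma push_char_map v s : disc R (cell_dim e) v ->
  push (chi e v) s = chi e (stretch v s).
Proof.
move=> /disc_sphere[vD|vS]; rewrite /push.
  by rewrite asboolT ?cell_coordK//; exists v.
by rewrite asboolF ?stretch_sphere//; exact: sphere_not_open.
Qed.

Lemma push_id x s : ~ open_cell e x -> push x s = x.
Proof. by move=> nex; rewrite /push asboolF. Qed.

Lemma push0 x : push x 0 = x.
Proof.
rewrite /push; case: asboolP => // -[v vD <-].
by rewrite cell_coordK// stretch0.
Qed.

Lemma push1 x : x <> center -> open_cell e x ->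
  (chi e @` sphere R (cell_dim e)) (push x 1).
Proof.
move=> xc [v vD vx]; rewrite -vx push_char_map; last exact: open_disc_disc.
exists (stretch v 1) => //; apply: stretch1_sphere.
by apply/eqP => v0; apply: xc; rewrite -vx v0.
Qed.

(** Two closed pieces cover the domain: on F the motion is constant, and on the
    closed cell it is induced by the stretching of the punctured disc. *)
Lemma homotopy_push (F : set X) : closed F -> ~ F center ->
  (forall x, F x -> ~ open_cell e x) ->
  homotopy ((F `|` closed_cell e) `\ center) push.
Proof.
move=> cF nFc Fe; set D := _ `\ center.
have cl (G : set X) : closed G -> closed [set p : X * R | G p.1].
  by move=> cG; apply: (closed_comp _ cG) => p _; exact: cvg_fst.
apply: (within_closed_glue (cl _ cF) (cl _ (closed_cell_closed (e := e)))).
- by move=> [x s] [[/= Fx _] _].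
- apply: (@within_eq _ _ _ fst); last exact: within_fst.
  by move=> [x s] [_ /= Fx]; rewrite push_id//; exact: Fe.
pose q (p : 'rV[R]_(cell_dim e) * R) := (chi e p.1, p.2).
have qc : {within disc R (cell_dim e) `*` `[0, 1], continuous q}.
  apply: within_pair; last exact: within_snd.
  apply: (within_comp _ (@char_map_continuous R X K e)); first exact: within_fst.
  by move=> p [].
have cK : compact (disc R (cell_dim e) `*` `[(0 : R), 1]).
  by apply: compact_setX; [exact: disc_compact|exact: segment_compact].
have hXR : hausdorff_space (X * R)%type.
  by apply: hausdorff_prod => //; exact: norm_hausdorff.
have sub : (D `*` `[(0 : R), 1]) `&` [set p | closed_cell e p.1] `<=`
    (D `*` `[(0 : R), 1]) `&` q @` (disc R (cell_dim e) `*` `[(0 : R), 1]).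
  move=> [x s] [[/= Dx s01] [v vD vx]]; split=> //.
  by exists (v, s) => //; rewrite /q /= vx.
apply: (within_continuous_subset sub).
apply: (within_compact_quotient hXR cK qc).
apply: (@within_eq _ _ _ (fun p => chi e (stretch p.1 p.2))).
  by move=> [v s] [[/= vD _] _]; rewrite push_char_map.
have Dv0 (p : 'rV[R]_(cell_dim e) * R) : D (chi e p.1) -> p.1 != 0.
  by move=> [_ nc]; apply/eqP => p0; apply: nc; rewrite p0.
apply: (within_comp (stretch_continuous _) (@char_map_continuous R X K e)).
  by move=> p [_ [/= Dp _]]; exact: Dv0.
move=> [v s] [[/= vD s01] [/= Dp _]].
apply: stretch_disc => //.
exact: (Dv0 (v, s)).
Qed.

End Push.

(** The open set O is taken in X, although only its trace on F moves: this avoids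
    the subspace topology of the partial unions of cells. *)
Definition neighborhood_retraction (F B O : set X) (r : X -> R -> X) :=
  [/\ open O, B `<=` O `&` F, homotopy (O `&` F) r,
      forall x, (O `&` F) x -> r x 0 = x /\ B (r x 1)
    & forall x t, B x -> r x t = x].

(** Points of the new cell are pushed to its boundary first, provided that they
    arrive in the given neighbourhood. *)
Lemma neighborhood_retraction_cell (e : cell K) (F B O : set X) r :
  closed F -> (forall x, F x -> ~ open_cell e x) ->
  chi e @` sphere R (cell_dim e) `<=` F -> neighborhood_retraction F B O r ->
  exists O' r', neighborhood_retraction (F `|` open_cell e) B O' r'.
Proof.
move=> cF Fe eF [oO BO rc rO rB]; set F' := F `|` open_cell e.
have nFc : ~ F (center e) by move=> /Fe; apply; exact: open_cell_center.
pose D := F' `\ center e.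
have pc : homotopy D (push e).
  apply: homotopy_subset (homotopy_push cF nFc Fe) => x [[Fx|ex] xc]; split=> //.
    by left.
  by right; exact: open_cell_closed_cell.
have p1F x : D x -> F (push e x 1).
  move=> [F'x xc]; have [ex|nex] := pselect (open_cell e x).
    by apply: eF; exact: push1.
  by rewrite push_id//; case: F'x.
have c1 : {within D, continuous (push e ^~ 1)}.
  by apply: homotopy_end pc _; rewrite ler01 lexx.
pose O' := [set x | nbhs x [set y | D y -> O (push e y 1)]] `\ center e.
have O'F x : (O' `&` F') x -> D x /\ (O `&` F) (push e x 1).
  move=> [[/nbhs_singleton Ox xc] F'x]; have Dx : D x by [].
  by split=> //; split; [exact: Ox|exact: p1F].
exists O', (concat (push e) (fun x => r (push e x 1))); split.
- apply: openI.
    by rewrite openE => x; rewrite /= => /nbhs_interior.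
  apply/closed_openC/accessible_closed_set1; exact: hausdorff_accessible.
- move=> x Bx; have [Ox Fx] := BO x Bx.
  have xc : x <> center e by move=> xc; apply: nFc; rewrite -xc.
  split; last by left.
  split=> //; have Dx : D x by split=> //; left.
  move/within_nbhsP: c1 => /(_ x Dx O); apply.
  by rewrite push_id; [exact: open_nbhs_nbhs|exact: Fe].
- apply: homotopy_concat.
  + by apply: homotopy_subset pc => x /O'F[].
  + apply: (homotopy_within rc (f := fun p => push e p.1 1)) (@within_snd _ _ _) _.
      apply: (within_comp (@within_fst _ _ _) c1); by move=> p [/O'F[]].
    by move=> p [/O'F[_ ?] /=]; rewrite in_itv.
  + by move=> x /O'F[_ /rO[]].
- move=> x /O'F[Dx Ox]; rewrite concat0 push0 concat1; split=> //.
  by have [] := rO _ Ox.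
- move=> x t Bx; have [Ox Fx] := BO x Bx.
  by rewrite /concat !push_id ?rB ?if_same//; exact: Fe.
Qed.

(** No boundary meets e: that of a cell of J outside J0 lies in cells of lower
    dimension than e, and that of a cell of J0 lies in cells of J0. *)
Lemma boundary_closed_rem (J0 J : {set cell K}) (e : cell K) :
  boundary_closed J0 -> boundary_closed J -> J0 \subset J -> e \in J :\: J0 ->
  (forall e', e' \in J :\: J0 -> (cell_dim e' <= cell_dim e)%N) ->
  boundary_closed (J :\ e).
Proof.
move=> J0c Jc J0J eJ emax e'; rewrite !inE => /andP[e'e e'J].
have J0e : cells_union J0 `<=` cells_union (J :\ e).
  move=> x [f /= fJ0 fx]; exists f => //=; rewrite !inE (fintype.subsetP J0J)// andbT.
  by apply: contraTneq fJ0 => ->; move: eJ; rewrite inE => /andP[].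
have [e'J0|e'J0] := boolP (e' \in J0).
  by move=> x /(J0c _ e'J0)/J0e.
have e'dim : (cell_dim e' <= cell_dim e)%N by apply: emax; rewrite inE e'J0.
move=> _ [v /disc_sphere[vD|vS] <-].
  by exists e'; [rewrite /= !inE e'e|exists v].
have [|f /= fdim fv] := @cell_boundary R X K e' (chi e' v); first by exists v.
exists f => //=; rewrite !inE; apply/andP; split.
  by apply: contraTneq fdim => ->; rewrite -leqNgt.
apply: (cells_union_mem fv); apply: (Jc e') => //.
by exists v => //; exact: sphere_disc.
Qed.

(** Induction on the number of cells, removing one of maximal dimension among those
    outside J0. *)
Lemma cells_union_retraction (J0 J : {set cell K}) :
  boundary_closed J0 -> boundary_closed J -> J0 \subset J ->
  exists O r, neighborhood_retraction (cells_union J) (cells_union J0) O r.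
Proof.
move=> J0c; have [m] := ubnP #|J|; elim: m J => // m IH J Jm Jc J0J.
have [->|JJ0] := eqVneq J J0.
  exists setT, (fun x _ => x); split=> //.
  - exact: openT.
  - by apply: within_continuous_subset (@within_fst _ _ setT).
  - by move=> x [].
have [e0 e0J] : exists e, e \in J :\: J0.
  apply/set0Pn; apply: contraNneq JJ0 => /eqP.
  by rewrite finset.setD_eq0 finset.eqEsubset J0J andbT.
case: (@arg_maxnP _ e0 (mem (J :\: J0)) (@cell_dim R X K) e0J) => e eJ emax.
have {}eJ : e \in J :\: J0 := eJ.
have eJ' : e \in J by move: eJ; rewrite inE => /andP[].
have Jec : boundary_closed (J :\ e) by exact: boundary_closed_rem eJ emax.
have [||O [r Or]] := IH (J :\ e) _ Jec.
- by move: Jm; rewrite (cardsD1 e J) eJ'.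
- by rewrite subsetD1 J0J; move: eJ; rewrite inE => /andP[].
have JE : cells_union J = cells_union (J :\ e) `|` open_cell e.
  apply/seteqP; split=> [x [f fJ fx]|x [[f /= fJ fx]|ex]].
  - by have [<-|fe] := eqVneq f e; [right|left; exists f => //=; rewrite !inE fe].
  - by exists f => //=; move: fJ; rewrite !inE => /andP[].
  - by exists e.
rewrite JE; apply: neighborhood_retraction_cell Or.
- exact: cells_union_closed.
- move=> x xJ ex; have := cells_union_mem ex xJ; by rewrite !inE eqxx.
- move=> _ [v vS <-]; have [|f /= fdim fv] := @cell_boundary R X K e (chi e v).
    by exists v.
  exists f => //=; rewrite !inE; apply/andP; split.
    by apply: contraTneq fdim => ->; rewrite ltnn.
  apply: (cells_union_mem fv); apply: (Jc e) => //.
  by exists v => //; exact: sphere_disc.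
Qed.

Lemma subcomplex_cells (B : set X) : subcomplex K B ->
  exists2 J : {set cell K}, boundary_closed J & B = cells_union J.
Proof.
move=> [cB [J BE]]; pose J' := [set e | `[< J e >]]%SET.
have BJ' : B = cells_union J'.
  rewrite BE; apply/seteqP; split=> x [e eJ ex]; exists e => //=.
    by rewrite inE; exact/asboolP.
  by move: eJ; rewrite /= inE => /asboolP.
exists J' => // e eJ'; rewrite -BJ'; apply: closed_cell_sub_closed => //.
by rewrite BJ' => x ex; exists e.
Qed.

Lemma subcomplex_retraction (B : set X) : subcomplex K B ->
  exists O r, neighborhood_retraction setT B O r.
Proof.
move=> /subcomplex_cells[J Jc ->].
have JT : cells_union [set: cell K] = [set: X].
  apply/seteqP; split=> // x; rewrite -(cells_cover K) => -[e _ ex].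
  by exists e => //=; rewrite inE.
rewrite -JT; apply: cells_union_retraction => //.
  by move=> e _; rewrite JT.
Qed.

End Cells.

(** * Bump functions *)

Lemma urysohn_closed_open (R : realType) (X : topologicalType) (F W : set X) :
  hausdorff_space X -> compact [set: X] -> closed F -> open W -> F `<=` W ->
  exists f : X -> R, [/\ continuous f, forall x, 0 <= f x <= 1,
    forall x, F x -> f x = 1 & forall x, ~ W x -> f x = 0].
Proof.
move=> hX cX cF oW FW.
have /(normal_separatorP (R := R)) sep := compact_normal hX cX.
have WF0 : ~` W `&` F = set0 by apply/seteqP; split=> // x [nW /FW].
have {}sep := sep _ _ (open_closedC oW) cF WF0.
exists (Urysohn (~` W) F); split.
- exact: Urysohn_continuous.
- move=> x; have := @Urysohn_range X R (~` W) F _ (imageP _ (I : setT x)).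
  by rewrite /= in_itv.
- by move=> x Fx; apply: (Urysohn_sub1 sep); exists x.
- by move=> x Wx; apply: (Urysohn_sub0 sep); exists x.
Qed.

(** The function is 1 near F, and 0 near the complement of W, which lets cut-off
    motions be continuous and complete on an open set. *)
Lemma bump_function (R : realType) (X : topologicalType) (F W : set X) :
  hausdorff_space X -> compact [set: X] -> closed F -> open W -> F `<=` W ->
  exists (chi : X -> R) (W' : set X), [/\ continuous chi,
    forall x, 0 <= chi x <= 1, open W' /\ F `<=` W',
    forall x, W' x -> chi x = 1 & forall x, ~ W x -> \forall y \near x, chi y = 0].
Proof.
move=> hX cX cF oW FW.
have [f [fc f01 fF fW]] := urysohn_closed_open R hX cX cF oW FW.
have near_lt (a b : R) x : a < f x < b -> \forall y \near x, a < f y < b.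
  move=> /andP[af fb]; have afc := fc x _ (lt_nbhsr af).
  have fbc := fc x _ (lt_nbhsl fb).
  by apply: filterS2 (afc : nbhs x _) (fbc : nbhs x _) => y /= -> ->.
(* the values of f below 1/3 and above 2/3 are levelled *)
exists (clip 0 1 \o (fun x => 3 * f x + (-1))), [set x | 2 / 3 < f x < 2].
split.
- move=> x; apply: continuous_comp; last exact: continuous_clip.
  apply: (@continuous_comp _ _ _ f (fun t => 3 * t + (-1))); first exact: fc.
  exact: continuous_affine.
- by move=> x; apply: clip_bounds; rewrite ler01.
- split; first by rewrite openE => x /=; exact: near_lt.
  by move=> x /fF /= ->; lra.
- move=> x /= fx; have := clip_cases (3 * f x + (-1)) (@ler01 R).
  by case=> [[? ->]|[? ->]|[? ->]]; lra.
- move=> x /fW fx0; have : (-1) < f x < 1 / 3 by rewrite fx0; lra.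
  move=> /near_lt; apply: filterS => y /= fy.
  have fy01 := f01 y; have := clip_cases (3 * f y + (-1)) (@ler01 R).
  by case=> [[? ->]|[? ->]|[? ->]]; lra.
Qed.

Lemma open_within_preimage (X Y : topologicalType) (D : set X) (W : set Y)
    (f : X -> Y) : open D -> {within D, continuous f} -> open W ->
  open (D `&` f @^-1` W).
Proof.
move=> oD /within_nbhsP fc oW; rewrite openE => x [Dx Wx].
have nD : nbhs x D by exact: open_nbhs_nbhs.
have nW : nbhs (f x) W by exact: open_nbhs_nbhs.
by apply: filterS2 nD (fc x Dx W nW) => y Dy Wy; split=> //; exact: Wy.
Qed.

(** * Comparison of forms with the same class *)

Section Comparison.
Context {R : realType}.
Implicit Types X Y : topologicalType.

Lemma clamp0 : clamp 0 = 0 :> R.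
Proof. by rewrite /clamp min_r ?ler01// maxxx. Qed.

Lemma clamp1 : clamp 1 = 1 :> R.
Proof. by rewrite /clamp minxx max_r ?ler01. Qed.

Lemma vertex_std_simplex : (\row_(i < 1) 1 : 'rV[R]_1) \in std_simplex R 0.
Proof.
apply/mem_set; split=> [i|]; first by rewrite mxE ler01.
by rewrite big_ord1 mxE.
Qed.

Definition vertex : set_type (std_simplex R 0) := SigSub vertex_std_simplex.

Lemma std_simplex0E (x : set_type (std_simplex R 0)) : x = vertex.
Proof.
apply: val_inj; apply/rowP => i; rewrite !ord1 mxE.
by have [_] := set_valP x; rewrite big_ord1.
Qed.

Definition point_simplex Y (y : Y) : singular_simplex R 0 Y :=
  [the continuousType _ _ of cst y].

Lemma coboundary_edge Y (b : cochain R 0 Y) (s : singular_simplex R 1 Y) :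
  coboundary b s = b (point_simplex (s (edge 1))) - b (point_simplex (s (edge 0))).
Proof.
have faceE (j : 'I_2) (t : R) : (forall x, face j x = edge t) ->
    singular_face j s = point_simplex (s (edge t)).
  by move=> jt; apply/continuousEP => x; rewrite /= jt.
rewrite /coboundary !big_ord_recl big_ord0 addr0 expr0 mul1r expr1 mulN1r.
congr (b _ - b _); apply: faceE => x; rewrite (std_simplex0E x).
  apply: val_inj; apply/rowP => i; rewrite !mxE /= clamp1.
  by case: unliftP => [k ->|->]; [rewrite (ord1 k) mxE|rewrite eqxx subrr].
apply: val_inj; apply/rowP => i; rewrite !mxE /= clamp0.
by case: unliftP => [k ->|->]; [rewrite (ord1 k) mxE /= subr0|].
Qed.

Lemma path_simplex_exists Y (g : R -> Y) : {within `[0, 1], continuous g} ->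
  exists s : singular_simplex R 1 Y, forall x, s x = g (val x 0 1).
Proof.
move=> /within_nbhsP gc; pose s (x : set_type (std_simplex R 1)) := g (val x 0 1).
have sc : continuous s.
  have x01 (x : set_type (std_simplex R 1)) : `[0, 1]%classic (val x 0 1).
    have [x0 x1] := set_valP x; rewrite /= in_itv /= x0 -x1 /=.
    have <- : lift ord0 ord0 = 1 :> 'I_2 by exact: val_inj.
    by rewrite !big_ord_recl big_ord0 addr0 lerDr; exact: x0.
  have vc : continuous (fun x : set_type (std_simplex R 1) => val x 0 1).
    move=> y; apply: (@continuous_comp _ _ _ set_val (fun v : 'rV[R]_2 => v 0 1)).
      exact: initial_continuous.
    exact: coord_continuous.
  move=> x W Wx; have nW : nbhs x _ := vc x _ (gc _ (x01 x) W Wx).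
  by apply: filterS nW => y; apply; exact: x01.
by exists [the continuousType _ _ of mkcts sc].
Qed.

(** Pulling back along a map f, [w'] = f^*[w] means that the integrals of w' and
    of w along f differ by the increments of a function. *)
Lemma pull_line_integral X Y (f : continuousType X Y) (w : closed_form R Y)
    (w' : closed_form R X) (xi : H1 R Y) :
  represents w xi -> represents w' (H1_pull f xi) ->
  exists beta : X -> R, forall (g : R -> X) (t : R), {within `[0, 1], continuous g} ->
    0 <= t <= 1 -> line_integral w' g 0 t =
      line_integral w (f \o g) 0 t + beta (g t) - beta (g 0).
Proof.
rewrite /represents /H1_pull /= /pull_coset; have [c _ ->] := H1_cosetP xi.
rewrite /= /cohomologous => -[b wE] [c2 [b1 c2E] [b2 w'E]].
(* b, b1 and b2 relate the cochain of w to a cocycle c of xi, another cocycle c2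
   of xi to c, and the cochain of w' to the pullback of c2 *)
pose beta x := b2 (point_simplex x) + b1 (point_simplex (f x)) -
  b (point_simplex (f x)).
exists beta.
suff main (g : R -> X) : {within `[0, 1], continuous g} ->
    line_integral w' g 0 1 = line_integral w (f \o g) 0 1 + beta (g 1) - beta (g 0).
  move=> g t gc t01; pose g' s := g (s * t).
  have g'c : {within `[0, 1], continuous g'}.
    apply: (within_comp _ gc) => [|s]; first exact/continuous_subspaceT/mulrr_continuous.
    by rewrite /= !in_itv /= => s01; nra.
  have := main _ g'c; rewrite /g' mul1r mul0r.
  rewrite (line_integral_scale _ gc)// ?mul1r; last by rewrite ler01 lexx.
  have fgc : {within `[0, 1], continuous (f \o g)}.
    apply: (within_comp gc (E := setT)) => //.
    by apply: continuous_subspaceT; exact: cts_fun.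
  move=> ->; congr (_ + _ - _); rewrite -[in RHS](mul1r t).
  by rewrite -(line_integral_scale _ fgc)// ler01 lexx.
move=> gc.
have [s sE] := path_simplex_exists gc.
have fsE t : 0 <= t <= 1 -> s (edge t) = g t.
  by move=> t01; rewrite sE mxE /= /clamp min_r ?max_r//; lra.
have fgE : line_integral w (f \o g) 0 1 = form_cochain w (f \o s).
  by apply: line_integral_eq => // t t01; rewrite /= fsE.
have gE : line_integral w' g 0 1 = form_cochain w' s.
  by apply: line_integral_eq => // t t01; rewrite /= fsE.
rewrite fgE gE w'E /pull_cochain c2E wE !coboundary_edge /= !fsE ?lexx ?ler01//.
rewrite /beta; lra.
Qed.

End Comparison.

(** * Paths and motions in a subspace *)

Lemma open_set_type (X : topologicalType) (B : set X) (U : set (set_type B)) :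
  open U -> exists2 V : set X, open V & U = @sub_val X B @^-1` V.
Proof. by move=> [V oV VU]; exists V. Qed.

Lemma nbhs_set_type (X : topologicalType) (B : set X) (y : set_type B)
    (U : set (set_type B)) : nbhs y U ->
  exists2 V : set X, nbhs (sub_val y) V & @sub_val X B @^-1` V `<=` U.
Proof.
rewrite nbhsE => -[U' [/open_set_type[V oV ->] Vy] VU].
by exists V => //; exists V.
Qed.

Lemma within_sub_val (T X : topologicalType) (B : set X) (D : set T)
    (f : T -> set_type B) : {within D, continuous (@sub_val X B \o f)} ->
  {within D, continuous f}.
Proof.
move=> /within_nbhsP fc; apply/within_nbhsP => x Dx W /nbhs_set_type[V Vx VW].
by apply: filterS (fc x Dx V Vx) => y Vy Dy; apply: VW; exact: Vy.
Qed.

Lemma compact_continuous_bounded (R : realType) (T : topologicalType)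
    (D : set T) (f : T -> R) : compact D -> {within D, continuous f} ->
  exists M, forall x, D x -> `|f x| <= M.
Proof.
move=> cD fc; have /compact_bounded := continuous_compact fc cD.
case=> M0 [_ fM]; exists (M0 + 1) => x Dx.
by apply: (fM (M0 + 1)); [rewrite ltrDl|exists x].
Qed.

(** On a closed cell of B, the increment of beta from the centre is the difference
    of two integrals along a ray. These depend continuously on the ray, so they
    are bounded by compactness of the disc. *)
Lemma increments_bounded (R : realType) (X : topologicalType) (K : finite_cw R X)
    (B : set X) (w : closed_form R X) (w' : closed_form R (set_type B))
    (beta : set_type B -> R) : subcomplex K B ->
  (forall (g : R -> set_type B) (t : R), {within `[0, 1], continuous g} ->
    0 <= t <= 1 -> line_integral w' g 0 t =
      line_integral w (@sub_val X B \o g) 0 t + beta (g t) - beta (g 0)) ->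
  exists2 M, 0 <= M & forall y, `|beta y| <= M.
Proof.
move=> /subcomplex_cells[J Jc BE] ww'.
have JB e : e \in J -> closed_cell e `<=` B by rewrite BE; exact: Jc.
suff cellM (e : cell K) : exists M, e \in J -> forall y : set_type B,
    closed_cell e (sub_val y) -> `|beta y| <= M.
  have [M MP] := choice cellM; exists (\sum_(e : cell K) `|M e|).
    by apply: sumr_ge0 => e _.
  move=> y; have : B (sub_val y) by exact: set_mem (valP y).
  rewrite {1}BE => -[e eJ ey]; rewrite (bigD1 e)//=; apply: ler_wpDr.
    by apply: sumr_ge0.
  apply: le_trans (ler_norm _).
  by apply: MP => //; exact: open_cell_closed_cell.
have [eJ|] := boolP (e \in J); last by exists 0.
set n := cell_dim e.
have chiB v : disc R n v -> B (char_map v) by move=> vD; apply: (JB e eJ); exists v.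
have y0B : @char_map R X K e 0 \in B by apply/mem_set/chiB/open_disc_disc/open_disc0.
pose y0 : set_type B := SigSub y0B.
pose h (v : 'rV[R]_n) (t : R) : set_type B := insubd y0 (@char_map R X K e (t *: v)).
have hE v t : disc R n v -> 0 <= t <= 1 ->
    sub_val (h v t) = @char_map R X K e (t *: v).
  by move=> vD t01; rewrite /sub_val val_insubd mem_set//; apply: chiB; exact: disc_scale.
have hc' : homotopy (disc R n) (fun v t => sub_val (h v t)).
  apply: (@within_eq _ _ _ (fun p : 'rV[R]_n * R => @char_map R X K e (p.2 *: p.1))).
    by move=> [v t] [/= vD]; rewrite in_itv /= => t01; rewrite hE.
  apply: (within_comp _ (@char_map_continuous R X K e)
    (f := fun p : 'rV[R]_n * R => p.2 *: p.1)).
    apply: continuous_subspaceT => p.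
    by apply: cvgZ; [exact: cvg_snd|exact: cvg_fst].
  move=> [v t] [/= vD]; rewrite in_itv /= => t01; exact: disc_scale.
have hc : homotopy (disc R n) h by exact: within_sub_val hc'.
have I1 (Y : topologicalType) (u : closed_form R Y) (k : 'rV[R]_n -> R -> Y) :
    homotopy (disc R n) k ->
    exists M, forall v, disc R n v -> `|line_integral u (k v) 0 1| <= M.
  move=> kc; apply: compact_continuous_bounded; first exact: disc_compact.
  apply: (homotopy_end (h := fun v t => line_integral u (k v) 0 t)).
    exact: line_integral_continuous.
  by rewrite ler01 lexx.
have [M1 M1P] := I1 _ w _ hc'; have [M2 M2P] := I1 _ w' _ hc.
exists (M2 + M1 + `|beta (h 0 0)|) => _ y [v vD vy].
have h1 : h v 1 = y.
  by apply: val_inj; rewrite -[RHS]vy -[LHS]/(sub_val _) hE ?ler01 ?lexx// scale1r.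
have h0 : h v 0 = h 0 0 by rewrite /h !scale0r.
have := ww' (h v) 1 (homotopy_path hc vD); rewrite ler01 lexx => /(_ isT).
rewrite h1 h0 => bE.
have -> : beta y = line_integral w' (h v) 0 1 +
    - line_integral w (@sub_val X B \o h v) 0 1 + beta (h 0 0) by rewrite bE; lra.
apply: le_trans (ler_normD _ _) _; rewrite lerD2r.
apply: le_trans (ler_normD _ _) _; rewrite normrN; apply: lerD; first exact: M2P.
exact: M1P.
Qed.

(** The motion g seen in X, where the points outside B rest. *)
Definition sub_homotopy (R : realType) (X : topologicalType) (B : set X)
    (g : set_type B -> R -> set_type B) (x : X) (t : R) : X :=
  if insub x is Some y then sub_val (g y t) else x.

Lemma sub_homotopyE (R : realType) (X : topologicalType) (B : set X)
    (g : set_type B -> R -> set_type B) (y : set_type B) :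
  sub_homotopy g (sub_val y) = @sub_val X B \o g y.
Proof. by apply/funext => t; rewrite /sub_homotopy /sub_val valK. Qed.

Lemma homotopy_sub (R : realType) (X : topologicalType) (B : set X)
    (V : set (set_type B)) (g : set_type B -> R -> set_type B) :
  homotopy V g -> homotopy (@sub_val X B @` V) (sub_homotopy g).
Proof.
move=> /within_nbhsP gc; apply/within_nbhsP => -[_ t] [/= [y Vy <-] t01] W.
rewrite sub_homotopyE /= => Wy.
have nW : nbhs (g y t) (@sub_val X B @^-1` W) by exact: sub_val_continuous Wy.
have [[P Q] /= [/nbhs_set_type[P' P'y P'P] tQ] PQ] := gc (y, t) (conj Vy t01) _ nW.
exists (P', Q) => //= -[x s] /= [P'x Qs] [[z Vz zx] s01].
rewrite -zx sub_homotopyE; apply: (PQ (z, s)) => //; split=> //=.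
by apply: P'P; rewrite /= zx.
Qed.

(** * Movable sets *)

Section Movability.
Context {R : realType} {X : topologicalType}.
Implicit Types (A B O U V : set X) (w : closed_form R X) (h r g : X -> R -> X).

(** A motion r of a neighbourhood O into B along which w rises by at most 1. The
    bound is uniform, as it enters a constant which is chosen before N. *)
Record retracts_near w B O r : Prop := RetractsNear {
  retr_open : open O;
  retr_sub : B `<=` O;
  retr_homotopy : homotopy O r;
  retr_start : forall x, O x -> r x 0 = x;
  retr_end : forall x, O x -> B (r x 1);
  retr_fix : forall x t, B x -> r x t = x;
  retr_le1 : forall x t, O x -> 0 <= t <= 1 -> line_integral w (r x) 0 t <= 1 }.

(** This differs from movability relative to B in that B is fixed pointwise; the
    integral rises to c at most, and ends at a or below for the points which do
    not end in B. *)
Record stationary_motion w B U h (a c : R) : Prop := StationaryMotion {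
  motion_homotopy : homotopy U h;
  motion_start : forall x, U x -> h x 0 = x;
  motion_fix : forall x t, B x -> h x t = x;
  motion_end : forall x, U x -> B (h x 1) \/ line_integral w (h x) 0 1 <= a;
  motion_le : forall x t, U x -> 0 <= t <= 1 -> line_integral w (h x) 0 t <= c }.

Let unit1 : 0 <= (1 : R) <= 1. Proof. by rewrite ler01 lexx. Qed.

(** Integrals along r vanish on B, so they are small near B. *)
Lemma subcomplex_retracts_near (K : finite_cw R X) w B : subcomplex K B ->
  exists O r, retracts_near w B O r.
Proof.
move=> /subcomplex_retraction[] O [r]; rewrite /neighborhood_retraction !setIT.
move=> [oO BO rc rO rB].
pose P x := forall t, 0 <= t <= 1 -> line_integral w (r x) 0 t <= 1.
pose O1 := O `&` [set x | nbhs x P].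
have O1O x : O1 x -> O x by case.
have rO1 x : O1 x -> P x by case=> _ /nbhs_singleton.
exists O1, r; split.
- by apply: openI => //; rewrite openE => x; rewrite /= => /nbhs_interior.
- move=> b Bb; have Ob := BO b Bb; split=> //=.
  have nO : nbhs b O by exact: open_nbhs_nbhs.
  suff : \forall y \near b, forall t : R, 0 <= t <= 1 ->
      O y -> line_integral w (r y) 0 t <= 1.
    by apply: filterS2 nO => y Oy yt t t01; exact: yt.
  apply: near_forall_unit => t t01.
  have bt : (O `*` `[(0 : R), 1]) (b, t) by split=> //=; rewrite in_itv.
  have /within_nbhsP/(_ _ bt) := @line_integral_continuous _ _ w _ _ _ rc.
  move=> /(_ [set u : R | u < 1]); rewrite /=.
  have -> : r b = fun=> b by apply/funext => s; exact: rB.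
  rewrite line_integral_cst// => /(_ (lt_nbhsl (@ltr01 R))).
  by apply: filterS => -[y s] /= ys s01 Oy; apply/ltW/ys; split.
- exact: homotopy_subset O1O rc.
- by move=> x /O1O /rO[].
- by move=> x /O1O /rO[].
- by [].
- by move=> x t /rO1; exact.
Qed.

(** First slide a neighbourhood of B onto B, then run the given motion for a
    time which vanishes on B. Where that time is not the full one, the slide
    has already ended in B. *)
Lemma movable_stationary w B O r U (N : nat) (c : R) : hausdorff_space X ->
  compact [set: X] -> closed B -> retracts_near w B O r -> open U ->
  movable w B N c U -> exists h, stationary_motion w B U h (1 - N%:R) (1 + c).
Proof.
move=> hX cX cB [oO BO rc r0 r1 rB rle] oU [BU [h [hc h0 hB h1 hle]]].
(* the slide must not leave the domain of h *)
pose P x := forall s : R, 0 <= s <= 1 -> O x -> U (r x s).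
pose O' := (O `&` U) `&` [set x | nbhs x P].
have oO' : open O'.
  apply: openI; first exact: openI.
  by rewrite openE => x; rewrite /= => /nbhs_interior.
have BO' : B `<=` O'.
  move=> b Bb; split; first by split; [exact: BO|exact: BU].
  apply: near_forall_unit => s s01.
  have bs : (O `*` `[(0 : R), 1]) (b, s) by split=> /=; [exact: BO|rewrite in_itv].
  have nU : nbhs (r b s) U by rewrite rB//; apply: open_nbhs_nbhs; split=> //; exact: BU.
  have /within_nbhsP/(_ _ bs _ nU) := rc.
  by apply: filterS => -[y u] /= yu u01 Oy; apply: yu; split.
have [lam [lamc lam01 lamB lam0]] := urysohn_closed_open R hX cX cB oO' BO'.
(* psi is the time for r, which vanishes near the complement of O'; phi is the
   time for h, which vanishes on B *)
pose psi := clip 0 1 \o (fun x => 4 * lam x + (-1)).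
pose phi := clip 0 1 \o (fun x => (-2) * lam x + 2).
have aff (a b : R) : continuous (clip 0 1 \o (fun x => a * lam x + b)).
  move=> x; apply: continuous_comp; last exact: continuous_clip.
  apply: (@continuous_comp _ _ _ lam (fun t => a * t + b)); first exact: lamc.
  exact: continuous_affine.
have psi01 x : 0 <= psi x <= 1 by apply: clip_bounds; rewrite ler01.
have phi01 x : 0 <= phi x <= 1 by apply: clip_bounds; rewrite ler01.
have lamO x : lam x != 0 -> O' x.
  by move=> lx; apply: contrapT => /lam0 l0; rewrite l0 eqxx in lx.
have phi_psi x : phi x < 1 -> psi x = 1 /\ O' x.
  rewrite /phi /psi /= => px.
  have lx : 1 / 2 < lam x.
    rewrite ltNge; apply/negP => lx; move: px.
    by rewrite /clip min_r ?max_r ?ltxx//; lra.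
  split; last by apply: lamO; lra.
  by rewrite /clip min_r ?max_r//; lra.
pose k1 := cutoff id r psi.
pose k2 x t := h (k1 x 1) (t * phi x).
have psi0 x : ~ O' x -> psi x = 0.
  by move=> /lam0; rewrite /psi /= => ->; rewrite /clip min_l ?max_l//; lra.
have k1c : homotopy U k1.
  apply: (homotopy_cutoff oO) => //.
  - by apply: continuous_subspaceT => x; exact: cvg_id.
  - exact: aff.
  - move=> x Ux nOx; have lx : lam x < 1 / 4.
      by rewrite lam0; [lra|case=> -[]].
    have nl : nbhs x _ := lamc x _ (lt_nbhsl lx).
    apply: filterS nl => y /= ly.
    by have := lam01 y; rewrite /psi /= /clip min_l ?max_l//; lra.
have k10 x : k1 x 0 = x.
  rewrite /k1; apply: cutoff0; have [/r0|nOx] := pselect (O x); first by right.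
  by left; apply: psi0; case=> -[].
have k1U x : U x -> U (k1 x 1).
  move=> Ux; rewrite /k1 /cutoff; case: ifPn => // px; rewrite mul1r.
  have [[Ox _] /nbhs_singleton Px] : O' x.
    by apply: contrapT => /psi0 p0; rewrite p0 eqxx in px.
  exact: Px.
have k2c : homotopy U k2.
  apply: (homotopy_within hc (f := fun p : X * R => k1 p.1 1)
    (tau := fun p : X * R => p.2 * phi p.1)).
  - apply: (within_comp (@within_fst _ _ _) (homotopy_end k1c unit1)).
    by move=> p [].
  - apply: continuous_subspaceT => p; apply: cvgM; first exact: cvg_snd.
    by apply: (@continuous_comp _ _ _ fst phi); [exact: cvg_fst|exact: aff].
  - move=> [x t] [/= Ux]; rewrite in_itv /= => t01; split; first exact: k1U.
    by have := phi01 x; nra.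
have k20 x : U x -> k2 x 0 = k1 x 1.
  by move=> Ux; rewrite /k2 mul0r h0//; exact: k1U.
have k1le x t : U x -> 0 <= t <= 1 -> line_integral w (k1 x) 0 t <= 1.
  move=> Ux t01; apply: (line_integral_cutoff_le rc r0) => //.
    by have [|/psi0] := pselect (O' x); [case=> -[]; right|left].
  by move=> Ox s s01; exact: rle.
have k2E x t : U x -> 0 <= t <= 1 ->
    line_integral w (k2 x) 0 t = line_integral w (h (k1 x 1)) 0 (t * phi x).
  move=> Ux t01; rewrite -(line_integral_scale _ (homotopy_path hc (k1U x Ux)))//.
exists (concat k1 k2); split.
- exact: homotopy_concat.
- by move=> x Ux; rewrite concat0.
- move=> b t Bb; have k1b s : k1 b s = b by rewrite /k1 /cutoff rB// if_same.
  have phib : phi b = 0.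
    by rewrite /phi /= lamB// /clip min_l ?max_l//; lra.
  by rewrite /concat /k2 !k1b phib mulr0 h0 ?if_same//; exact: BU.
- move=> x Ux; rewrite concat1 (line_integral_concat1 w k1c k2c k20)//.
  have /andP[_] := phi01 x.
  rewrite le_eqVlt => /predU1P[phi1|/phi_psi[psi1 O'x]].
    have := h1 _ (k1U x Ux); rewrite k2E// /k2 phi1 !mul1r.
    by have := k1le x 1 Ux unit1 => le1 [Bh|hN]; [left|right; lra].
  left; rewrite /k2 mul1r; apply: hB => //.
  by rewrite /k1 cutoff_on//; apply: r1; case: O'x => -[].
- move=> x t Ux t01; apply: (line_integral_concat_le k1c k2c k20) => //.
    by move=> s s01; exact: k1le.
  move=> s s01; rewrite k2E//; apply: hle; first exact: k1U.
  by have := phi01 x; nra.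
Qed.

(** Once h has brought a point near B, it can be slid onto B and then moved by a
    homotopy g which is only defined in B. *)
Definition continuation h r g (x : X) : R -> X :=
  concat r (fun y => g (r y 1)) (h x 1).

Definition continuation_dom U h O r V :=
  U `&` (h ^~ 1) @^-1` (O `&` (r ^~ 1) @^-1` V).

Section Continuation.
Context (w : closed_form R X) (B O U V : set X) (h r g : X -> R -> X) (a c : R).
Context (oU : open U) (oV : open V).
Context (rB : retracts_near w B O r) (hB : stationary_motion w B U h a c).
Context (gc : homotopy (V `&` B) g) (g0 : forall y, (V `&` B) y -> g y 0 = y).

Let D := continuation_dom U h O r V.
Let k := continuation h r g.
Let slid := O `&` (r ^~ 1) @^-1` V.

Let slid_VB y : slid y -> (V `&` B) (r y 1).
Proof. by move=> [Oy Vy]; split=> //; exact: (retr_end rB). Qed.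

Let rc : homotopy slid r.
Proof. by apply: homotopy_subset (retr_homotopy rB) => y []. Qed.

Let rgc : homotopy slid (fun y => g (r y 1)).
Proof.
apply: (homotopy_within gc (f := fun p : X * R => r p.1 1)) (@within_snd _ _ _) _.
  by apply: (within_comp (@within_fst _ _ _) (homotopy_end rc unit1)) => p [].
by move=> p [/slid_VB ? /=]; rewrite in_itv.
Qed.

Let rg0 y : slid y -> g (r y 1) 0 = r y 1.
Proof. by move=> /slid_VB /g0. Qed.

Lemma continuation_dom_open : open D.
Proof.
apply: (open_within_preimage oU); first exact: homotopy_end (motion_homotopy hB) unit1.
apply: (open_within_preimage (retr_open rB)) => //.
exact: homotopy_end (retr_homotopy rB) unit1.
Qed.

Lemma homotopy_continuation : homotopy D k.
Proof.
apply: (homotopy_within (homotopy_concat rc rgc rg0)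
  (f := fun p : X * R => h p.1 1)) (@within_snd _ _ _) _.
  have h1c := homotopy_end (motion_homotopy hB) unit1.
  by apply: (within_comp (@within_fst _ _ _) h1c) => p [[]].
by move=> p [[_ Dp] /=]; rewrite in_itv.
Qed.

Lemma continuation0 x : D x -> k x 0 = h x 1.
Proof. by move=> [_ [Ox _]]; rewrite /k /continuation concat0 (retr_start rB). Qed.

Lemma continuation1 x : k x 1 = g (r (h x 1) 1) 1.
Proof. exact: concat1. Qed.

Lemma continuation_le d x t :
  (forall y s, (V `&` B) y -> 0 <= s <= 1 -> line_integral w (g y) 0 s <= d) ->
  D x -> 0 <= t <= 1 -> line_integral w (k x) 0 t <= 1 + d.
Proof.
move=> gle [Ux sx] t01; apply: (line_integral_concat_le rc rgc rg0) => // s s01.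
  by apply: (retr_le1 rB) => //; case: sx.
by apply: gle => //; exact: slid_VB.
Qed.

Lemma continuation_le1 x : D x ->
  line_integral w (k x) 0 1 <= 1 + line_integral w (g (r (h x 1) 1)) 0 1.
Proof.
move=> [Ux sx]; rewrite (line_integral_concat1 w rc rgc rg0)// lerD2r.
by apply: (retr_le1 rB) => //; case: sx.
Qed.

Lemma continuation_null_homotopic x0 :
  (forall y, (V `&` B) y -> g y 1 = x0) -> null_homotopic_incl R X D.
Proof.
move=> g1; exists (concat h k), x0; split.
- apply: homotopy_concat homotopy_continuation continuation0.
  by apply: homotopy_subset (motion_homotopy hB) => x [].
- by move=> x [Ux _]; rewrite concat0 (motion_start hB).
- by move=> x [_ /slid_VB]; rewrite concat1 continuation1; exact: g1.
Qed.

(** The continuation is complete near S and cut off away from it. A point near S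
    ends in A or has descended by g, while any other point of U' has descended
    by h to level a + 1, which the partial continuation raises by 1 + d at most.
    The strict bound a + 1 instead of a makes the set of those points open. *)
Lemma continuation_movable A S (d e C : R) (N : nat) : hausdorff_space X ->
  compact [set: X] -> closed S -> S `<=` D -> A `<=` S -> A `<=` B ->
  0 <= d ->
  (forall x t, A x -> 0 <= t <= 1 -> A (g x t)) ->
  (forall y, (V `&` B) y -> A (g y 1) \/ line_integral w (g y) 0 1 <= e) ->
  (forall y s, (V `&` B) y -> 0 <= s <= 1 -> line_integral w (g y) 0 s <= d) ->
  c + 1 + e <= - N%:R -> a + 1 + 1 + d <= - N%:R -> c + 1 + d <= C ->
  exists U', [/\ open U', S `<=` U',
    U `&` [set x | line_integral w (h x) 0 1 < a + 1] `<=` U'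
    & movable w A N C U'].
Proof.
move=> hX cX cS SD AS AB d0 gA g1 gle ceN adN cdC.
pose G := U `&` [set x | line_integral w (h x) 0 1 < a + 1].
have oG : open G.
  apply: (@open_within_preimage _ _ U [set u : R | u < a + 1]
    (fun x => line_integral w (h x) 0 1)) (@open_lt R (a + 1)) => //.
  apply: (homotopy_end (h := fun x t => line_integral w (h x) 0 t)) unit1.
  exact: line_integral_continuous (motion_homotopy hB).
have [chi [W' [chic chi01 [oW' SW'] chiW chi0]]] :=
  bump_function R hX cX cS continuation_dom_open SD.
have W'D x : W' x -> D x.
  move=> Wx; apply: contrapT => /chi0/nbhs_singleton; rewrite chiW// => /eqP.
  by rewrite oner_eq0.
have hc := motion_homotopy hB.
pose l := cutoff (h ^~ 1) k chi; pose U' := W' `|` G.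
have U'U x : U' x -> U x by case=> [/W'D[]|[]].
have lc : homotopy U' l.
  apply: homotopy_cutoff homotopy_continuation continuation0 _ _ _ _ => //.
  - exact: continuation_dom_open.
  - by apply: within_continuous_subset (homotopy_end hc unit1).
  - by move=> x _ /chi0.
have l0 x : U' x -> l x 0 = h x 1.
  move=> _; apply: cutoff0; have [/continuation0|/chi0/nbhs_singleton] := pselect (D x).
    by right.
  by left.
have hc' : homotopy U' h by exact: homotopy_subset hc.
have lle x t : U' x -> 0 <= t <= 1 -> line_integral w (l x) 0 t <= 1 + d.
  move=> _ t01; apply: (line_integral_cutoff_le homotopy_continuation continuation0) => //.
  - by rewrite addr_ge0.
  - by have [|/chi0/nbhs_singleton] := pselect (D x); [right|left].
  - by move=> Dx s; exact: continuation_le.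
exists U'; split.
- exact: openU.
- by move=> x /SW'; left.
- by move=> x Gx; right.
split; first by move=> x /AS/SW'; left.
exists (concat h l); split.
- exact: homotopy_concat.
- by move=> x /U'U Ux; rewrite concat0 (motion_start hB).
- move=> x t Ax t01; have Bx := AB x Ax.
  have hx s : h x s = x by exact: (motion_fix hB).
  apply: concat_cases => // s s01; first by rewrite hx.
  rewrite /l /cutoff; case: ifPn => _; first by rewrite hx.
  rewrite /k /continuation hx; apply: concat_cases => [|u _|u u01].
  - by have := chi01 x; nra.
  - by rewrite (retr_fix rB).
  - by rewrite (retr_fix rB)//; exact: gA.
- move=> x U'x; rewrite concat1 (line_integral_concat1 w hc' lc l0)//.
  have hle := motion_le hB (U'U x U'x) unit1.
  case: (U'x) => [Wx|[Ux /= hG]]; last first.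
    by right; have := lle x 1 U'x unit1; lra.
  rewrite /l cutoff_on ?chiW// continuation1.
  have Dx := W'D x Wx; have := slid_VB Dx.2 => /g1[|ge]; first by left.
  by right; have := continuation_le1 Dx; lra.
- move=> x t U'x t01; apply: le_trans cdC; rewrite -addrA.
  apply: (line_integral_concat_le hc' lc l0) => // s s01.
    exact: (motion_le hB (U'U x U'x)).
  exact: lle.
Qed.

End Continuation.

End Movability.

(** * Subadditivity *)

Section Subspace.
Context {R : realType} {X : topologicalType} (B : set X).

Lemma sub_val_image (V : set X) : @sub_val X B @` (@sub_val X B @^-1` V) = V `&` B.
Proof.
apply/seteqP; split=> [_ [y Vy <-]|x [Vx Bx]].
  by split=> //; exact: set_mem (valP y).
by exists (SigSub (mem_set Bx)).
Qed.

Lemma sub_null_homotopic (V : set X) :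
  null_homotopic_incl R (set_type B) (@sub_val X B @^-1` V) ->
  exists (g : X -> R -> X) (x0 : X), [/\ homotopy (V `&` B) g,
    forall y, (V `&` B) y -> g y 0 = y & forall y, (V `&` B) y -> g y 1 = x0].
Proof.
move=> [g [y0 [gc g0 g1]]]; exists (sub_homotopy g), (sub_val y0).
rewrite -sub_val_image; split; first exact: homotopy_sub.
  by move=> _ [y Vy <-]; rewrite sub_homotopyE /= g0.
by move=> _ [y Vy <-]; rewrite sub_homotopyE /= g1.
Qed.

(** Comparing w' with w costs 2 * M, a bound for the increments of beta. *)
Lemma sub_movable (w : closed_form R X) (w' : closed_form R (set_type B))
    (beta : set_type B -> R) (M : R) (A V : set X) (N : nat) (c : R) :
  (forall (g : R -> set_type B) (t : R), {within `[0, 1], continuous g} ->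
    0 <= t <= 1 -> line_integral w' g 0 t =
      line_integral w (@sub_val X B \o g) 0 t + beta (g t) - beta (g 0)) ->
  (forall y, `|beta y| <= M) -> A `<=` B ->
  movable w' (@sub_val X B @^-1` A) N c (@sub_val X B @^-1` V) ->
  A `<=` V /\ exists g : X -> R -> X, [/\ homotopy (V `&` B) g,
    forall y, (V `&` B) y -> g y 0 = y,
    forall x t, A x -> 0 <= t <= 1 -> A (g x t),
    forall y, (V `&` B) y ->
      A (g y 1) \/ line_integral w (g y) 0 1 <= 2 * M - N%:R
    & forall y t, (V `&` B) y -> 0 <= t <= 1 ->
      line_integral w (g y) 0 t <= c + 2 * M].
Proof.
move=> ww' betaM AB [AV [g [gc g0 gA g1 gle]]]; split.
  by move=> x Ax; exact: (AV (SigSub (mem_set (AB x Ax)))).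
have cmp y t : sub_val y \in V -> 0 <= t <= 1 ->
    line_integral w (@sub_val X B \o g y) 0 t <= line_integral w' (g y) 0 t + 2 * M.
  move=> /set_mem Vy t01; have := ww' (g y) t (homotopy_path gc Vy) t01.
  have := betaM (g y t); have := betaM (g y 0); rewrite !ler_norml; lra.
exists (sub_homotopy g); rewrite -sub_val_image; split.
- exact: homotopy_sub.
- by move=> _ [y Vy <-]; rewrite sub_homotopyE /= g0.
- move=> x t Ax t01; have := sub_homotopyE g (SigSub (mem_set (AB x Ax))).
  by rewrite [sub_val _]/= => ->; exact: gA.
- move=> _ [y Vy <-]; rewrite sub_homotopyE.
  have := cmp y 1 (mem_set Vy); rewrite ler01 lexx => /(_ isT) cy.
  by have [Ag|gN] := g1 y Vy; [left|right; lra].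
- move=> _ t [y Vy <-] t01; rewrite sub_homotopyE.
  by have := cmp y t (mem_set Vy) t01; have := gle y t Vy t01; lra.
Qed.

End Subspace.

(** The constant for A is the sum of those for B and for A in B, of 2 * M for the
    comparison of the forms, and of 1 for each use of the retraction. *)
Lemma cat_admissible_add (R : realType) (X : topologicalType)
    (K : finite_cw R X) (A B : set X) (xi : H1 R X) (m n : nat) :
  subcomplex K A -> subcomplex K B -> A `<=` B -> cat_admissible B xi m ->
  cat_admissible (sub_incl B @^-1` A) (H1_pull (sub_incl B) xi) n ->
  cat_admissible A xi (m + n).
Proof.
move=> hA hB AB [w wxi [c c0 Bcov]] [w' w'xi [d d0 Acov]]; exists w => //.
have hX := cw_hausdorff K; have cX := cw_compact K.
have [beta ww'] := pull_line_integral wxi w'xi.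
have [M M0 betaM] := increments_bounded hB ww'.
have [ O [r rB]] := subcomplex_retracts_near w hB.
exists (c + d + 2 * M + 2); first by lra.
move=> N _; pose N' := (Num.truncn (N%:R + c + d + 2 * M + 3)).+1.
have N'E : N%:R + c + d + 2 * M + 3 < N'%:R by exact: truncnS_gt.
have [U [Ui [oU oUi Ucov Ui0 Umov]]] := Bcov N' isT.
have [V [Vj [oV oVj Vcov Vj0 Vmov]]] := Acov N' isT.
have [h hh] := movable_stationary hX cX hB.1 rB oU Umov.
have [V' oV' VE] := open_set_type oV; rewrite {}VE in Vcov Vmov.
have /choice[Vj' Vj'P] j : exists W, open W /\ Vj j = @sub_val X B @^-1` W.
  by have [W oW WE] := open_set_type (oVj j); exists W.
have [AV' [g [gc g0 gA g1 gle]]] := sub_movable ww' betaM AB Vmov.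
pose D W := continuation_dom U h O r W.
pose G := U `&` [set x | line_integral w (h x) 0 1 < 1 - N'%:R + 1].
(* D (Vj' j) consists of the points of U which h and then r bring into V_j *)
pose W (i : 'I_(m + n)) : set X :=
  match fintype.split i with inl i => Ui i | inr j => D (Vj' j) end.
have oW i : open (W i).
  rewrite /W; case: fintype.split => // j.
  exact: continuation_dom_open oU (Vj'P j).1 rB hh.
have oG : open G.
  apply: (@open_within_preimage _ _ U [set u : R | u < 1 - N'%:R + 1]
    (fun x => line_integral w (h x) 0 1)) (@open_lt R _) => //.
  apply: (homotopy_end (h := fun x t => line_integral w (h x) 0 t)).
    exact: line_integral_continuous (motion_homotopy hh).
  by rewrite ler01 lexx.
(* what the other sets leave uncovered, together with A *)
pose S := A `|` ~` (G `|` \bigcup_i W i).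
have cS : closed S.
  apply: closedU; first exact: hA.1.
  by apply: open_closedC; apply: openU => //; exact: bigcup_open.
have DE V0 x : U x -> B (h x 1) -> V0 (h x 1) -> D V0 x.
  by move=> Ux Bh Vh; split=> //; split; [exact: (retr_sub rB)|rewrite /= (retr_fix rB)].
have SD : S `<=` D V'.
  move=> x [Ax|nGW].
    have Bx := AB x Ax; have hx := motion_fix hh 1 Bx.
    by apply: DE; rewrite ?hx//; [exact: Umov.1|exact: AV'].
  have nW i : ~ W i x by move=> Wx; apply: nGW; right; exists i.
  have Ux : U x.
    have : (U `|` \bigcup_i Ui i) x by rewrite Ucov.
    case=> // -[i _ Uix]; case: (nW (unsplit (inl i))).
    by rewrite /W unsplitK.
  have Bh : B (h x 1).
    have [//|hN] := motion_end hh Ux; case: nGW; left; split=> //=.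
    by apply: le_lt_trans hN _; rewrite ltrDl.
  have : ((@sub_val X B @^-1` V') `|` \bigcup_i Vj i) (SigSub (mem_set Bh)).
    by rewrite Vcov.
  case=> [Vh|[j _]]; first exact: DE.
  rewrite (Vj'P j).2 => Vh; case: (nW (unsplit (inr j))).
  by rewrite /W unsplitK; exact: DE.
have [||||U' [oU' SU' GU' U'mov]] := continuation_movable oU oV' rB hh gc g0
  hX cX cS SD (fun x Ax => or_introl Ax) AB _ gA g1 gle
  (N := N) (C := c + d + 2 * M + 2).
- lra.
- lra.
- lra.
- lra.
exists U', W; split=> //.
- apply/seteqP; split=> // x _.
  have [|nGW] := pselect ((G `|` \bigcup_i W i) x).
    by case=> [/GU'|]; [left|right].
  by left; apply: SU'; right.
- move=> i; rewrite /W; case: fintype.split => [//|j].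
  have [Wo WE] := Vj'P j.
  have [gj [x0 [gjc gj0 gj1]]] : exists (g : X -> R -> X) (x0 : X), [/\
      homotopy (Vj' j `&` B) g, forall y, (Vj' j `&` B) y -> g y 0 = y
      & forall y, (Vj' j `&` B) y -> g y 1 = x0].
    by apply: sub_null_homotopic; rewrite -WE.
  exact: continuation_null_homotopic rB hh gjc gj0 x0 gj1.
Qed.

Lemma relcat_ge0 (R : realType) (X : topologicalType) (B : set X) (xi : H1 R X) :
  (0 <= relcat B xi)%E.
Proof. by apply: le_ereal_inf_tmp => y [k _ ky]; rewrite -ky lee_fin ler0n. Qed.

Lemma relcat_attained (R : realType) (X : topologicalType) (B : set X)
    (xi : H1 R X) : relcat B xi = +oo%E \/
  exists2 k, cat_admissible B xi k & relcat B xi = k%:R%:E.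
Proof.
have [[k Pk]|nP] := pselect (exists k, cat_admissible B xi k); last first.
  left; rewrite /relcat (_ : [set _ | _ in _] = set0) ?ereal_inf0//.
  by apply/seteqP; split=> // y [k Pk _]; case: nP; exists k.
right; have exP : exists k, `[< cat_admissible B xi k >] by exists k; apply/asboolP.
have [l /asboolP Pl lmin] := ex_minnP exP; exists l => //.
apply/le_anti/andP; split; first by apply: ereal_inf_lbound; exists l.
apply/le_ereal_inf_tmp => y [j Pj jy]; rewrite -jy lee_fin ler_nat.
by apply: lmin; apply/asboolP.
Qed.

Theorem theorem1p1 (R : realType) (X : topologicalType) (K : finite_cw R X)
    (A B : set X) (hA : subcomplex K A) (hB : subcomplex K B)
    (hAB : A `<=` B) (xi : H1 R X) :
  (relcat A xi <= relcat B xi +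
     relcat (sub_incl B @^-1` A) (H1_pull (sub_incl B) xi))%E.
Proof.
have [->|[m Pm ->]] := relcat_attained B xi.
  by rewrite addye ?leey// -ltNye (lt_le_trans _ (relcat_ge0 _ _)).
have [->|[n Pn ->]] := relcat_attained (sub_incl B @^-1` A) (H1_pull (sub_incl B) xi).
  by rewrite addey ?leey.
rewrite -EFinD -natrD; apply: ereal_inf_lbound; exists (m + n)%N => //.
exact: cat_admissible_add hA hB hAB Pm Pn.
Qed.
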